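(* Under the standing setup below (in particular Assumptions 1 and 2, and the assumption that $\mathbf 1_{\Omega_n}\to 1$ almost surely), the operators $\widehat Q_{n,h}$ converge to $Q_h$ in operator norm on $W(\mathcal L(t))$: $$\big\|\widehat{Q}_{n,h}-Q_h\big\|_{W}:=\sup\Big\{\big\|\widehat Q_{n,h}g-Q_hg\big\|_W:\ g\in W(\mathcal L(t)),\ \|g\|_W\le 1\Big\}\longrightarrow 0\quad\text{almost surely as }n\to\infty.$$
   Context: Standing setup. Let $X_1,X_2,\dots$ be i.i.d. random vectors in $\mathbb R^d$ with common law $\mu$ having a Lebesgue density $f$. For $s\in\mathbb R$ let $\mathcal L(s)=\{x\in\mathbb R^d: f(x)\ge s\}$, and for $a\le b$ let $\mathcal L_a^b=\{x: a\le f(x)\le b\}$. A level $t>0$ in the interior of the range of $f$ is fixed; $\mathcal L(t)$ is nonempty and compact, with finitely many connected components $\mathcal C_1,\dots,\mathcal C_\ell$, and $d_{min}=\min_{i\neq j}\mathrm{dist}(\mathcal C_i,\mathcal C_j)$. Assumption 1: (i) $f$ is of class $C^2$ on $\mathbb R^d$; (ii) $\|D_xf\|>0$ on $\{x: f(x)=t\}$; (iii) $f$, $D_xf$, $D_x^2f$ are uniformly bounded on $\mathbb R^d$. $B$ denotes the unit ball of $\mathbb R^d$ centered at $0$. Assumption 2: $k:\mathbb R^d\to\mathbb R_+$ satisfies (i) $k$ is $C^2$; (ii) the support of $k$ is $B$; (iii) $k$ is bounded from below on $B/2$ by a positive number; (iv) $k(-x)=k(x)$. For $h>0$, $k_h(u)=k(u/h)$.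 Fix $h>0$ and $\varepsilon_0>0$ such that $\mathcal L_{t-\varepsilon_0}^{t+\varepsilon_0}$ contains no critical point of $f$ and $\varepsilon_0/\alpha(\varepsilon_0)<h/2$, where $\alpha(\varepsilon_0)=\inf\{\|D_xf(x)\|: x\in\mathcal L_{t-\varepsilon_0}^t\}$. Let $(\varepsilon_n)$ be positive numbers with $\varepsilon_n\le\varepsilon_0$ and $\varepsilon_n\to0$. Let $(\varphi_n)$ be $C^1$ diffeomorphisms of $\mathbb R^d$ with $\varphi_n(\mathcal L(t))=\mathcal L(t-\varepsilon_n)$, $\sup_{x\in\mathcal L(t)}\|\varphi_n(x)-x\|\to0$ and $\sup_{x\in\mathcal L(t)}\|D_x\varphi_n(x)-I_d\|\to0$. For $\mathcal D\subset\mathbb R^d$, $W(\mathcal D)$ is the Banach space of complex-valued bounded continuously differentiable functions on $\mathcal D$ with bounded gradient, with norm $\|g\|_W=\|g\|_\infty+\|D_xg\|_\infty$. Empirical objects. Let $\widehat f_n$ be a differentiable density estimate built from $X_1,\dots,X_n$; $\mathcal L_n(t)=\{x:\widehat f_n(x)\ge t\}$; $J(n)=\{j\in\{1,\dots,n\}:\widehat f_n(X_j)\ge t\}$, $j(n)=\#J(n)$, $\mathbb P_n^t=\frac1{j(n)}\sum_{j\in J(n)}\delta_{X_j}$. Let $\Omega_n=[\|\widehat f_n-f\|_\infty\le\varepsilon_n]\cap[\inf\{\|D_x\widehat f_n(x)\|: x\in\mathcal L_{t-\varepsilon_0}^{t+\varepsilon_0}\}\ge\frac12\|D_xf\|_\infty]$;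 it is assumed that $\mathbf 1_{\Omega_n}\to1$ almost surely. (On $\Omega_n$, $\mathcal L(t+\varepsilon_n)\subset\mathcal L_n(t)\subset\mathcal L(t-\varepsilon_n)$.) Set $K_{n,h}(x)=\int_{\mathcal L_n(t)}k_h(y-x)\,\mathbb P_n^t(dy)$ and $q_{n,h}(x,y)=k_h(y-x)/K_{n,h}(x)$ (with $0/0=0$). On $\Omega_n$, $\widehat Q_{n,h}:W(\mathcal L(t))\to W(\mathcal L(t))$ is defined by $\widehat Q_{n,h}g(x)=\int_{\mathcal L_n(t)}q_{n,h}(\varphi_n(x),y)\,g(\varphi_n^{-1}(y))\,\mathbb P_n^t(dy)$ for $x\in\mathcal L(t)$; on $\Omega_n^c$, $\widehat Q_{n,h}$ is the zero operator. Limit objects. $\mu^t$ is the conditional law of $X_1$ given $X_1\in\mathcal L(t)$; $K_h(x)=\int_{\mathcal L(t)}k_h(y-x)\,\mu^t(dy)$; $q_h(x,y)=k_h(y-x)/K_h(x)$; $Q_h:W(\mathcal L(t))\to W(\mathcal L(t))$, $Q_hg(x)=\int_{\mathcal L(t)}q_h(x,y)g(y)\,\mu^t(dy)$. *)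

(* Defs.v *)
From HB Require Import structures.
From mathcomp Require Import all_boot all_order all_algebra.
From mathcomp Require Import all_classical all_reals all_analysis.
Set Implicit Arguments. Unset Strict Implicit. Unset Printing Implicit Defensive.
Import Order.TTheory GRing.Theory Num.Theory.
Import numFieldNormedType.Exports.
Local Open Scope classical_set_scope.
Local Open Scope ring_scope.

Section Defs.
Variables (R : realType) (d : nat).
Local Notation V := 'rV[R]_d.

Definition enorm (x : V) : R := Num.sqrt (\sum_(i < d) x ord0 i ^+ 2).

Definition evec (i : 'I_d) : V := delta_mx ord0 i.

Definition partial {W : normedModType R} (F : V -> W) (i : 'I_d) (x : V) : W :=
  'd F x (evec i).

Definition grad (F : V -> R) (x : V) : V := \row_i partial F i x.

Definition C1 {W : normedModType R} (F : V -> W) : Prop :=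
  (forall x, differentiable F x) /\ (forall i, continuous (partial F i)).

Definition C2 (F : V -> R) : Prop :=
  (forall x, differentiable F x) /\
  (forall i x, differentiable (partial F i) x) /\
  (forall i j, continuous (partial (partial F i) j)).

Definition C1_diffeo (phi psi : V -> V) : Prop :=
  cancel phi psi /\ cancel psi phi /\ C1 phi /\ C1 psi.

Definition borel_rV : set (set V) := <<s setT, [set A | open A] >>.

Definition lev (f : V -> R) (s : R) : set V := [set x | s <= f x].
Definition lev_ab (f : V -> R) (a b : R) : set V := [set x | a <= f x <= b].

Definition Ball1 : set V := [set x | enorm x <= 1].

Definition box (a b : nat -> R) : set V :=
  [set x | forall i : 'I_d, a i <= x ord0 i <= b i].

Fixpoint iint (k : nat) (a b : nat -> R) (F : (nat -> R) -> R) (x : nat -> R)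
  : \bar R :=
  match k with
  | 0%N => (F x)%:E
  | k'.+1 => (\int[@lebesgue_measure R]_(s in `[a k', b k'])
               iint k' a b F (fun j => if j == k' then s else x j))%E
  end.

(* integral of F over box [a,b] w.r.t. d-dimensional Lebesgue measure *)
Definition box_integral (a b : nat -> R) (F : V -> R) : \bar R :=
  iint d a b (fun x => F (\row_i x (nat_of_ord i))) (fun _ => 0).

(* complex-valued functions on R^d, as (real part, imaginary part) *)
Definition cfun := ((V -> R) * (V -> R))%type.

Definition cabs (g : cfun) (x : V) : R := Num.sqrt (g.1 x ^+ 2 + g.2 x ^+ 2).

Definition cgradnorm (g : cfun) (x : V) : R :=
  Num.sqrt (\sum_(i < d) (partial g.1 i x ^+ 2 + partial g.2 i x ^+ 2)).

Definition C1on (D : set V) (F : V -> R) : Prop :=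
  (forall x, D x -> differentiable F x) /\
  (forall i, {within D, continuous (partial F i)}).

Definition Wnorm (D : set V) (g : cfun) : \bar R :=
  if `[< C1on D g.1 /\ C1on D g.2 >] then
    (ereal_sup [set (cabs g x)%:E | x in D] +
     ereal_sup [set (cgradnorm g x)%:E | x in D])%E
  else +oo%E.

(* g belongs to W(D): C^1 on D, bounded, with bounded gradient *)
Definition inW (D : set V) (g : cfun) : Prop := (Wnorm D g < +oo)%E.

Definition csub (g1 g2 : cfun) : cfun := (g1.1 \- g2.1, g1.2 \- g2.2).

Definition opdist (D : set V) (A B : cfun -> cfun) : \bar R :=
  ereal_sup [set Wnorm D (csub (A g) (B g)) | g in [set g | (Wnorm D g <= 1)%E]].

End Defs.

Section Estimators.
Variables (R : realType) (d : nat) (dT : measure_display) (T : measurableType dT).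
Local Notation V := 'rV[R]_d.

Definition kh (k : V -> R) (h : R) (u : V) : R := k (h^-1 *: u).

(* J(n) = { j in 1..n : fhat_n(X_j) >= t }; sample X_1..X_n is X 0 .. X (n-1) *)
Definition Jset (X : nat -> T -> V) (fhatn : V -> R) (t : R) (n : nat) (w : T)
  : seq nat := [seq j <- iota 0 n | t <= fhatn (X j w)].

Definition Pnt_int (X : nat -> T -> V) (fhatn : V -> R) (t : R) (n : nat) (w : T)
  (G : V -> R) : R :=
  (size (Jset X fhatn t n w))%:R^-1 * \sum_(j <- Jset X fhatn t n w) G (X j w).

(* K_{n,h} and q_{n,h} (0/0 = 0 is MathComp's convention x/0 = 0) *)
Definition Knh X fhatn t n w (k : V -> R) (h : R) (x : V) : R :=
  Pnt_int X fhatn t n w (fun y => kh k h (y - x)).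
Definition qnh X fhatn t n w (k : V -> R) (h : R) (x y : V) : R :=
  kh k h (y - x) / Knh X fhatn t n w k h x.

Definition Omega_ev (f : V -> R) (fhatn : V -> R) (t e0 epsn : R) : Prop :=
  (forall x, `|fhatn x - f x| <= epsn) /\
  (forall x, t - e0 <= f x <= t + e0 ->
     sup [set enorm (grad f y) | y in setT] / 2 <= enorm (grad fhatn x)).

Definition Qhat (X : nat -> T -> V) (f : V -> R) (fhatn : V -> R) (t e0 epsn : R)
  (phin phiinvn : V -> V) (n : nat) (w : T) (k : V -> R) (h : R) (g : cfun R d)
  : cfun R d :=
  if `[< Omega_ev f fhatn t e0 epsn >] then
    (fun x => Pnt_int X fhatn t n w
                (fun y => qnh X fhatn t n w k h (phin x) y * g.1 (phiinvn y)),
     fun x => Pnt_int X fhatn t n w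
                (fun y => qnh X fhatn t n w k h (phin x) y * g.2 (phiinvn y)))
  else (fun _ => 0, fun _ => 0).

(* integral of G against mu^t, the law of X_1 conditioned on X_1 in L(t) *)
Definition mut_int (P : probability T R) (X1 : T -> V) (f : V -> R) (t : R)
  (G : V -> R) : R :=
  fine (\int[P]_w (\1_(lev f t) (X1 w) * G (X1 w))%:E)%E
  / fine (P (X1 @^-1` lev f t)).

Definition Kh P X1 f t (k : V -> R) (h : R) (x : V) : R :=
  mut_int P X1 f t (fun y => kh k h (y - x)).
Definition qh P X1 f t (k : V -> R) (h : R) (x y : V) : R :=
  kh k h (y - x) / Kh P X1 f t k h x.

Definition Qh P X1 f t (k : V -> R) (h : R) (g : cfun R d) : cfun R d :=
  (fun x => mut_int P X1 f t (fun y => qh P X1 f t k h x y * g.1 y),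
   fun x => mut_int P X1 f t (fun y => qh P X1 f t k h x y * g.2 y)).

End Estimators.

(* Main.v *)
(* Multiplying numerator and denominator by j(n)/n, respectively mu(L(t)), turns
   both operators into quotients A/D of unnormalised integrals of translates of
   the kernel, composed with phi_n, respectively with the identity.  A quotient
   and its gradient are built from A, D, their partial derivatives and the
   Jacobian of phi_n, and partial derivatives pass under the integral onto the
   kernel.  So everything reduces to a law of large numbers for
   y |-> kappa (y - x) g(y), kappa = k_h or d_i k_h, uniform in x and in g in the
   unit ball of W, plus the positivity of D on the compact set L(t).

   L(t) need not be convex, so a gradient bound on L(t) gives no global Lipschitz
   bound for g.  It does give one on balls contained in L(t): L(t + e) is covered
   by finitely many small balls inside L(t), on which g and its composition with
   phi_n^-1 are almost constant, and the remaining sample points lie in the band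
   |f - t| <= e.  Only finitely many frequencies are then involved, and their
   convergence follows from a second moment bound along the squares.  The mass of
   the band tends to mu(f = t) = 0: near a point where d_i f <> 0, arbitrarily many
   disjoint translates of a thickening of {f = t} along the i-th axis have
   comparable mass. *)
Require Import Defs.
From HB Require Import structures.
From mathcomp Require Import all_boot all_order all_algebra.
From mathcomp Require Import all_classical all_reals all_analysis measurable_realfun.
From mathcomp Require Import ring lra.
Import Order.TTheory GRing.Theory Num.Theory.
Import numFieldNormedType.Exports.
Local Open Scope classical_set_scope.
Local Open Scope ring_scope.
Set Implicit Arguments. Unset Strict Implicit. Unset Printing Implicit Defensive.

(** The null set has to be chosen before [g], [x] and the realised estimate, so randomness may enter
    only through frequencies of sets fixed in advance. This is why kernel integrals are compared
    with step functions on a fixed cover: [g] and the kernel change only their coefficients, and the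
    data-dependent selection by the estimate matters only in the band, where an error of the size of
    its mass is accepted. Only the kernel is differentiated in [x], never [g]; the gradient bound on
    [g] serves to control its oscillation on small balls. Moving a partial derivative onto the
    kernel is done once, for an abstract functional bounded in sup norm: a C2 kernel with compact
    support has a Taylor remainder that is quadratic uniformly in [y]. The empirical sum and the
    restricted expectation are both instances. The density is given through iterated integrals over
    boxes, that is, through two-sided bounds on masses of cubes; hence the level set is shown to be
    null by counting cubes. *)

Section RowVectorCalculus.
Context {R : realType} {d : nat}.
Local Notation V := 'rV[R]_d.
Implicit Types (x y u v : V) (F : V -> R).

(** * Sup norm (the norm of row vectors), Euclidean norm ([enorm]) and mean value bounds *)

Lemma coord_le_norm v i : `|v ord0 i| <= `|v|.
Proof.
rewrite [leRHS]/Num.norm /= mx_normrE.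
by apply: (le_bigmax _ (fun ij : 'I_1 * 'I_d => `|v ij.1 ij.2|) (ord0, i)).
Qed.

Lemma norm_le_coord v (c : R) : 0 <= c ->
  (forall i, `|v ord0 i| <= c) -> `|v| <= c.
Proof.
move=> c0 vc; rewrite [leLHS]/Num.norm /= mx_normrE.
by apply/bigmax_leP; split=> // -[i j] _ /=; rewrite (ord1 i).
Qed.

Lemma norm_lt_coord v (c : R) : 0 < c ->
  (forall i, `|v ord0 i| < c) -> `|v| < c.
Proof.
move=> c0 vc; rewrite [ltLHS]/Num.norm /= mx_normrE.
by apply/bigmax_ltP; split=> // -[i j] _ /=; rewrite (ord1 i).
Qed.

Lemma coord_le_enorm v i : `|v ord0 i| <= enorm v.
Proof.
rewrite /enorm -sqrtr_sqr ler_wsqrtr// (bigD1 i)//= lerDl.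
by apply: sumr_ge0 => j _; exact: sqr_ge0.
Qed.

Lemma enorm_ge0 v : 0 <= enorm v. Proof. exact: sqrtr_ge0. Qed.

Lemma norm_le_enorm v : `|v| <= enorm v.
Proof. by apply: norm_le_coord => [|i]; [exact: enorm_ge0|exact: coord_le_enorm]. Qed.

Lemma sqrt_sum_sqr_le (I : finType) (a : I -> R) :
  Num.sqrt (\sum_i a i ^+ 2) <= \sum_i `|a i|.
Proof.
rewrite -(@ger0_norm _ (\sum_i `|a i|)) ?sumr_ge0// -sqrtr_sqr.
apply: ler_wsqrtr.
(* Nonnegativity of the right-hand sum is carried through the induction, because the cross term of
   its square has to be dropped. *)
suff /andP[] : (\sum_i a i ^+ 2 <= (\sum_i `|a i|) ^+ 2) && (0 <= \sum_i `|a i|) by [].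
elim/big_ind2 : _ => /=.
- by rewrite expr0n/= !lexx.
- move=> s q s' q' /andP[sq q0] /andP[sq' q0']; rewrite addr_ge0// andbT.
  by rewrite sqrrD; have := mulr_ge0 q0 q0'; lra.
- by move=> i _; rewrite real_normK ?num_real// lexx normr_ge0.
Qed.

Lemma enorm_le_norm v : enorm v <= d%:R * `|v|.
Proof.
apply: (le_trans (sqrt_sum_sqr_le _)).
apply: (le_trans (ler_sum _ (fun i _ => coord_le_norm v i))).
by rewrite sumr_const card_ord mulr_natl.
Qed.

Lemma diff_sum_partial {W : normedModType R} (F : V -> W) x v :
  'd F x v = \sum_i v ord0 i *: partial F i x.
Proof.
rewrite [in LHS](row_sum_delta v) linear_sum.
by apply: eq_bigr => i _; rewrite linearZ.
Qed.

(** The one-variable mean value theorem along the segment. Differentiability is asked on the segment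
    alone, since [g] will be controlled only inside balls contained in L(t). *)
Lemma segment_MVT F x y :
  (forall s : R, 0 <= s <= 1 -> differentiable F (x + s *: (y - x))) ->
  exists2 s : R, 0 <= s <= 1 &
    F y - F x = \sum_i (y - x) ord0 i * partial F i (x + s *: (y - x)).
Proof.
move=> dF; pose p (s : R) : V := x + s *: (y - x).
have dp (s : R) : is_diff s p ( *:%R ^~ (y - x)).
  have -> : p = cst x + ( *:%R ^~ (y - x)) by [].
  by have := is_diffD (is_diff_cst x s) (is_diff_scalel s (y - x)); rewrite add0r.
have dFp (s : R) : 0 <= s <= 1 ->
    is_derive s 1 (F \o p) (\sum_i (y - x) ord0 i * partial F i (p s)).
  move=> s01; have [dps dpE] := dp s.
  have dd : differentiable (F \o p) s.
    by apply: differentiable_comp => //; exact: dF.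
  apply: (DeriveDef (diff_derivable dd)).
  rewrite deriveE// diff_comp//=; last exact: dF.
  by rewrite dpE scale1r diff_sum_partial.
have [|||s] := @MVT_segment R (F \o p)
    (fun s => \sum_i (y - x) ord0 i * partial F i (p s)) 0 1.
- by [].
- by move=> s; rewrite in_itv/= => /andP[s0 s1]; apply: dFp; rewrite !ltW.
- apply: derivable_within_continuous => s; rewrite in_itv/= => s01.
  by apply: ex_derive; exact: dFp.
rewrite in_itv/= => s01; rewrite subr0 mulr1 /p scale1r scale0r addr0 subrKC.
by exists s.
Qed.

Lemma partial_le_lipschitz F x y (B : R) :
  (forall s : R, 0 <= s <= 1 -> differentiable F (x + s *: (y - x))) ->
  (forall s : R, 0 <= s <= 1 -> forall i, `|partial F i (x + s *: (y - x))| <= B) ->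
  `|F y - F x| <= d%:R * B * `|y - x|.
Proof.
move=> dF bF; have [s s01 ->] := segment_MVT dF.
rewrite (le_trans (ler_norm_sum _ _ _))//.
apply: (@le_trans _ _ (\sum_(i < d) B * `|y - x|)).
  apply: ler_sum => i _; rewrite normrM mulrC ler_pM//; first exact: bF.
  exact: coord_le_norm.
by rewrite sumr_const card_ord -[leLHS]mulr_natl mulrA.
Qed.

Lemma ball_segment (c x y : V) (r s : R) : ball c r x -> ball c r y ->
  0 <= s <= 1 -> ball c r (x + s *: (y - x)).
Proof.
rewrite -!ball_normE /= => cx cy /andP[s0 s1].
have -> : c - (x + s *: (y - x)) = (1 - s) *: (c - x) + s *: (c - y).
  by apply/rowP => i; rewrite !mxE; ring.
rewrite (le_lt_trans (ler_normD _ _))// !normrZ (ger0_norm s0) ger0_norm ?subr_ge0//.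
(* The strict inequality below comes from the [y] part, which disappears when [s = 0]. *)
have [->|sn0] := eqVneq s 0; first by rewrite subr0 mul1r mul0r addr0.
have sp : 0 < s by rewrite lt_neqAle eq_sym sn0.
have -> : r = (1 - s) * r + s * r by ring.
by rewrite ler_ltD// ?ltr_pM2l// ler_wpM2l ?subr_ge0// ltW.
Qed.

Lemma ball_lipschitz F (c x y : V) (r B : R) : ball c r x -> ball c r y ->
  (forall z, ball c r z -> differentiable F z) ->
  (forall z, ball c r z -> forall i, `|partial F i z| <= B) ->
  `|F y - F x| <= d%:R * B * `|y - x|.
Proof.
move=> cx cy dF bF; apply: partial_le_lipschitz => s s01.
  by apply: dF; exact: ball_segment.
by apply: bF; exact: ball_segment.
Qed.

Lemma globally_lipschitz F (B : R) : (forall z, differentiable F z) ->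
  (forall z i, `|partial F i z| <= B) ->
  forall x y, `|F y - F x| <= d%:R * B * `|y - x|.
Proof. by move=> dF bF x y; apply: partial_le_lipschitz => // s _ i; exact: bF. Qed.

(** The mean value point lies within [|v|] of [x], so replacing its partials by those at [x] costs
    [C * |v|] per coordinate. *)
Lemma taylor_lipschitz F (C : R) : (forall z, differentiable F z) ->
  (forall i x y, `|partial F i y - partial F i x| <= C * `|y - x|) ->
  forall x v, `|F (x + v) - F x - \sum_i v ord0 i * partial F i x|
    <= d%:R * C * `|v| * `|v|.
Proof.
move=> dF lF x v.
have dFs (s : R) : 0 <= s <= 1 -> differentiable F (x + s *: (x + v - x)) by [].
have xvx : x + v - x = v by rewrite addrC addKr.
have [s /andP[s0 s1]] := segment_MVT dFs; rewrite xvx => ->.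
rewrite -sumrB (le_trans (ler_norm_sum _ _ _))//.
apply: (@le_trans _ _ (\sum_(i < d) (C * `|v| * `|v|))); last first.
  by rewrite sumr_const card_ord -[leLHS]mulr_natl !mulrA.
apply: ler_sum => i _; rewrite -mulrBr normrM mulrC ler_pM//; last exact: coord_le_norm.
have C0 : 0 <= C * `|v|.
  by have := lF i x (x + v); rewrite xvx; exact: le_trans.
rewrite (le_trans (lF i _ _))// (addrC x) addrK normrZ ger0_norm// mulrCA.
by rewrite -[leRHS]mul1r ler_wpM2r.
Qed.

End RowVectorCalculus.

(** * Expectations of bounded random variables *)

Section BoundedExpectation.
Context {R : realType} {dT : measure_display} {T : measurableType dT}.
Variable P : probability T R.
Implicit Types (F G : T -> R) (A : set T).

(** Boundedness is required everywhere: the class is then closed under ring operations and always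
    integrable, so [fine] in [Ex] meets no infinite value. *)
Definition bounded_rv F :=
  measurable_fun setT F /\ exists B : R, forall w, `|F w| <= B.

Definition Ex F : R := fine (\int[P]_w (F w)%:E)%E.

Lemma bounded_rv_cst (c : R) : bounded_rv (fun=> c).
Proof. by split; [exact: measurable_cst|exists `|c|]. Qed.

Lemma bounded_rv_indic A : measurable A -> bounded_rv (\1_A : T -> R).
Proof.
move=> mA; split; first exact: measurable_realfun.measurable_indic.
by exists 1 => w; rewrite indicE; case: (_ \in _); rewrite ?normr1 ?normr0.
Qed.

Lemma bounded_rvD F G : bounded_rv F -> bounded_rv G ->
  bounded_rv (fun w => F w + G w).
Proof.
move=> [mF [B bF]] [mG [C bG]]; split; first exact: measurable_funD.
by exists (B + C) => w; rewrite (le_trans (ler_normD _ _))// lerD.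
Qed.

Lemma bounded_rvM F G : bounded_rv F -> bounded_rv G ->
  bounded_rv (fun w => F w * G w).
Proof.
move=> [mF [B bF]] [mG [C bG]]; split; first exact: measurable_funM.
by exists (B * C) => w; rewrite normrM ler_pM.
Qed.

Lemma bounded_rvZ (c : R) F : bounded_rv F -> bounded_rv (fun w => c * F w).
Proof. by move=> bF; apply: bounded_rvM => //; exact: bounded_rv_cst. Qed.

Lemma bounded_rvB F G : bounded_rv F -> bounded_rv G ->
  bounded_rv (fun w => F w - G w).
Proof.
move=> bF bG; have -> : (fun w => F w - G w) = (fun w => F w + (-1) * G w).
  by apply/funext => w; rewrite mulN1r.
by apply: bounded_rvD => //; exact: bounded_rvZ.
Qed.

Lemma bounded_rv_sum (I : Type) (s : seq I) (F : I -> T -> R) :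
  (forall i, bounded_rv (F i)) -> bounded_rv (fun w => \sum_(i <- s) F i w).
Proof.
move=> bF; elim: s => [|i s ih].
  under eq_fun do rewrite big_nil; exact: bounded_rv_cst.
by under eq_fun do rewrite big_cons; exact: bounded_rvD.
Qed.

Lemma bounded_rv_integrable F : bounded_rv F -> P.-integrable setT (EFin \o F).
Proof.
move=> [mF [B bF]]; apply: measurable_bounded_integrable => //.
  exact: le_lt_trans (probability_le1 P measurableT) (ltry _).
exists B; split; first exact: num_real.
by move=> M BM w _ /=; rewrite (le_trans (bF w))// ltW.
Qed.

Lemma ExD F G : bounded_rv F -> bounded_rv G ->
  Ex (fun w => F w + G w) = Ex F + Ex G.
Proof. by move=> bF bG; apply: RintegralD => //; exact: bounded_rv_integrable. Qed.

Lemma ExB F G : bounded_rv F -> bounded_rv G ->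
  Ex (fun w => F w - G w) = Ex F - Ex G.
Proof. by move=> bF bG; apply: RintegralB => //; exact: bounded_rv_integrable. Qed.

Lemma ExZ (c : R) F : bounded_rv F -> Ex (fun w => c * F w) = c * Ex F.
Proof. by move=> bF; apply: RintegralZl => //; exact: bounded_rv_integrable. Qed.

Lemma Ex_cst (c : R) : Ex (fun=> c) = c.
Proof.
rewrite /Ex integral_cst//.
by rewrite [X in (_ * X)%E](_ : _ = 1%E) ?mule1//; exact: probability_setT.
Qed.

Lemma Ex_sum (I : Type) (s : seq I) (F : I -> T -> R) :
  (forall i, bounded_rv (F i)) ->
  Ex (fun w => \sum_(i <- s) F i w) = \sum_(i <- s) Ex (F i).
Proof.
move=> bF; elim: s => [|i s ih].
  by under eq_fun do rewrite big_nil; rewrite big_nil Ex_cst.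
under eq_fun do rewrite big_cons.
by rewrite big_cons ExD ?ih//; exact: bounded_rv_sum.
Qed.

Lemma Ex_le F G : bounded_rv F -> bounded_rv G ->
  (forall w, F w <= G w) -> Ex F <= Ex G.
Proof.
by move=> bF bG FG; apply: le_Rintegral => //; exact: bounded_rv_integrable.
Qed.

Lemma Ex_indic A : measurable A -> Ex (\1_A : T -> R) = fine (P A).
Proof. by move=> mA; rewrite /Ex integral_indic// setIT. Qed.

Lemma Ex_norm_le F G : bounded_rv F -> bounded_rv G ->
  (forall w, `|F w| <= G w) -> `|Ex F| <= Ex G.
Proof.
move=> bF bG FG; rewrite ler_norml; apply/andP; split.
  rewrite -mulN1r -ExZ//; apply: Ex_le => //; first exact: bounded_rvZ.
  by move=> w; rewrite mulN1r; have := FG w; rewrite ler_norml => /andP[].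
by apply: Ex_le => // w; have := FG w; rewrite ler_norml => /andP[].
Qed.

End BoundedExpectation.

(** A monotone count is squeezed between its values at two consecutive squares, whose gap is
    negligible against [n]. *)
Lemma cvg_freq_of_squares (R : realType) (S : nat -> R) (p : R) :
  {homo S : m n / (m <= n)%N >-> m <= n} -> 0 <= p <= 1 ->
  (forall e : R, 0 < e -> \forall m \near \oo,
     `|S (m ^ 2)%N - (m ^ 2)%:R * p| <= e * (m ^ 2)%:R) ->
  forall e : R, 0 < e -> \forall n \near \oo, `|S n - n%:R * p| <= e * n%:R.
Proof.
move=> ndS /andP[p0 p1] cS e e0.
(* Budget for the upper bound, with [x = m]: [4/7] of [e * x^2] for the deviation at [m.+1], as
   [(x + 1)^2 <= 4 * x^2], and [3/7] for the drift [p * (2 * x + 1) <= 3 * x], as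
   [7 * x <= e * x^2]. *)
have e70 : 0 < e / 7 by lra.
have [N _ HN] := cS _ e70.
pose M := maxn N.+1 (Num.truncn (7 / e)).+1.
exists (M ^ 2)%N => // n /= Mn.
have [m /andP[mn nm]] : exists m, (m ^ 2 <= n < m.+1 ^ 2)%N.
  elim: (n) => [|q [m /andP[mq qm]]]; first by exists 0%N.
  have [qm'|mq'] := ltnP q.+1 (m.+1 ^ 2); first by exists m; rewrite qm' (leq_trans mq).
  by exists m.+1; rewrite mq'/= (leq_ltn_trans qm)// ltn_exp2r.
have Mm : (M <= m)%N.
  by rewrite -ltnS -(@ltn_exp2r _ _ 2)//; exact: leq_ltn_trans Mn nm.
have mN : (N <= m)%N by apply: leq_trans Mm; rewrite leq_max ltnW.
have em : 7 / e <= m%:R.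
  rewrite (le_trans (ltW (truncnS_gt _)))// ler_nat.
  by apply: leq_trans Mm; rewrite leq_max leqnn orbT.
have m1 : 1 <= m%:R :> R.
  by rewrite (ler_nat _ 1); apply: leq_trans Mm; rewrite leq_max.
have Hm := HN m mN; have HSm := HN m.+1 (leqW mN).
have Smn := ndS _ _ mn; have Snm := ndS _ _ (ltnW nm).
move: mn nm; rewrite -(ler_nat R) -(ltr_nat R) => mn /ltW nm.
move: Hm HSm Smn Snm mn nm; rewrite !natrX -[m.+1%:R]natr1.
move: em; rewrite ler_pdivrMr//.
move: (S (m ^ 2)%N) (S (m.+1 ^ 2)%N) (S n) (m%:R : R) (n%:R : R) m1.
move=> a b s x y x1 ex; rewrite !ler_norml => /andP[h1 h2] /andP[h3 h4] h5 h6 h7 h8.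
have xx : 7 * x <= e * x ^+ 2 by nra.
have x2 : (x + 1) ^+ 2 <= 4 * x ^+ 2 by nra.
have ey : e * x ^+ 2 <= e * y by rewrite ler_pM2l.
have ex2 : e / 7 * (x + 1) ^+ 2 <= e / 7 * (4 * x ^+ 2) by rewrite ler_pM2l.
have px : p * (2 * x + 1) <= 3 * x by nra.
have py1 : x ^+ 2 * p <= y * p by rewrite ler_wpM2r.
have py2 : y * p <= (x + 1) ^+ 2 * p by rewrite ler_wpM2r.
have pe : (x + 1) ^+ 2 * p = x ^+ 2 * p + p * (2 * x + 1) by ring.
by apply/andP; split; lra.
Qed.

(** * Strong law for frequencies of pairwise independent events *)

Section PairwiseLLN.
Context {R : realType} {dT : measure_display} {T : measurableType dT}.
Variables (P : probability T R) (A : nat -> set T) (p : R).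
Hypothesis mA : forall i, measurable (A i).
Hypothesis PA : forall i, P (A i) = p%:E.
Hypothesis PAA : forall i j, i != j -> P (A i `&` A j) = (p * p)%:E.

Let S n w : R := \sum_(i < n) \1_(A i) w.

Let p01 : 0 <= p <= 1.
Proof. by rewrite -!lee_fin -(PA 0) measure_ge0 probability_le1. Qed.

Let bS n c : bounded_rv (fun w => S n w - c).
Proof.
apply: bounded_rvB; last exact: bounded_rv_cst.
by apply: bounded_rv_sum => i; exact: bounded_rv_indic.
Qed.

(** Pairwise independence leaves only the diagonal of the double sum of centred indicators, that is
    [n * (p - p * p)]. *)
Let variance_le n : Ex P (fun w => (S n w - n%:R * p) ^+ 2) <= n%:R.
Proof.
pose Z i w : R := \1_(A i) w - p.
have bZ i : bounded_rv (Z i).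
  by apply: bounded_rvB; [exact: bounded_rv_indic|exact: bounded_rv_cst].
have -> : (fun w => (S n w - n%:R * p) ^+ 2) =
    (fun w => \sum_(i < n) \sum_(j < n) Z i w * Z j w).
  apply/funext => w.
  have -> : S n w - n%:R * p = \sum_(i < n) Z i w.
    by rewrite sumrB sumr_const card_ord mulr_natl.
  by rewrite expr2 big_distrlr.
rewrite Ex_sum; last first.
  by move=> i; apply: bounded_rv_sum => j; exact: bounded_rvM.
have EZ i j : Ex P (fun w => Z i w * Z j w) = (i == j)%:R * (p - p * p).
  have -> : (fun w => Z i w * Z j w) =
      (fun w => (\1_(A i `&` A j) w - p * \1_(A i) w) - (p * \1_(A j) w - p * p)).
    by apply/funext => w; rewrite /Z indicI/=; ring.
  have bi k : bounded_rv (fun w => p * \1_(A k) w).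
    by apply: bounded_rvZ; exact: bounded_rv_indic.
  have bij := bounded_rv_indic (R:=R) (measurableI _ _ (mA i) (mA j)).
  rewrite ExB; [|exact: bounded_rvB| ]; last first.
    by apply: bounded_rvB => //; exact: bounded_rv_cst.
  have bpp := @bounded_rv_cst R dT T (p * p).
  rewrite (ExB _ bij (bi i)) (ExB _ (bi j) bpp) Ex_cst !ExZ; [|exact: bounded_rv_indic..].
  rewrite !Ex_indic; [|exact: mA|exact: mA|exact: measurableI].
  rewrite !PA/=.
  have [<-|ij] := eqVneq i j; last by rewrite PAA//=; ring.
  by rewrite setIid PA/=; ring.
rewrite (eq_bigr (fun=> p - p * p)); last first.
  move=> i _; rewrite Ex_sum; last by move=> j; exact: bounded_rvM.
  rewrite (bigD1 i)//= EZ eqxx mul1r big1 ?addr0// => j ji.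
  by rewrite EZ (inj_eq val_inj) eq_sym (negbTE ji) mul0r.
rewrite sumr_const card_ord -[leLHS]mulr_natl ler_piMr//.
by case/andP: p01 => p0 p1; nra.
Qed.

Let Y m w : R := ((S (m.+1 ^ 2)%N w - (m.+1 ^ 2)%:R * p) / (m.+1 ^ 2)%:R) ^+ 2.

Let bY m : bounded_rv (Y m).
Proof.
have -> : Y m = (fun w =>
    ((m.+1 ^ 2)%:R^-1 * (S (m.+1 ^ 2)%N w - (m.+1 ^ 2)%:R * p)) *
    ((m.+1 ^ 2)%:R^-1 * (S (m.+1 ^ 2)%N w - (m.+1 ^ 2)%:R * p))).
  by apply/funext => w; rewrite /Y expr2 !(mulrC _^-1).
by apply: bounded_rvM; apply: bounded_rvZ; exact: bS.
Qed.

(** The variance bound gives [1 / x^2] with [x = m.+1], and [1 / x^2 <= 2 / (x * (x + 1))] for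
    [x >= 1] turns it into a telescoping term. *)
Let Ex_Y m : Ex P (Y m) <= 2 * (m.+1%:R^-1 - m.+2%:R^-1).
Proof.
have -> : Y m = (fun w => ((m.+1 ^ 2)%:R ^- 2) *
    (S (m.+1 ^ 2)%N w - (m.+1 ^ 2)%:R * p) ^+ 2).
  by apply/funext => w; rewrite /Y exprMn mulrC exprVn.
rewrite ExZ; last first.
  under eq_fun do rewrite expr2; apply: bounded_rvM; exact: bS.
have m0 : 0 < (m.+1 ^ 2)%:R :> R by rewrite ltr0n expn_gt0.
apply: (@le_trans _ _ ((m.+1 ^ 2)%:R^-1)).
  rewrite mulrC ler_pdivrMr ?exprn_gt0// expr2 mulrA mulVf ?gt_eqF// mul1r.
  exact: variance_le.
rewrite natrX -[m.+2%:R]natr1.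
have : 1 <= m.+1%:R :> R by rewrite ler1n.
move: (m.+1%:R : R) => x x1.
have x0 : x != 0 by rewrite gt_eqF// (lt_le_trans ltr01).
have x10 : x + 1 != 0 by rewrite gt_eqF//; lra.
have -> : 2 * (x^-1 - (x + 1)^-1) = 2 / (x * (x + 1)) by field; rewrite x0 x10.
rewrite -div1r ler_pdivrMr ?exprn_gt0 ?(lt_le_trans ltr01)//.
rewrite mulrAC ler_pdivlMr; last by nra.
by nra.
Qed.

(** The squared relative deviations along the squares have a series of expectation at most [2]; it
    is almost surely finite, so its terms tend to zero. One almost sure event serves every [e]. *)
Lemma pairwise_lln : {ae P, forall w, forall e : R, 0 < e ->
  \forall n \near \oo, `|S n w - n%:R * p| <= e * n%:R}.
Proof.
have EY m : (\int[P]_w (Y m w)%:E = (Ex P (Y m))%:E)%E.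
  rewrite /Ex fineK//; have := bounded_rv_integrable P (bY m).
  exact: integrable_fin_num.
have Y0 m w : (0 <= (Y m w)%:E)%E by rewrite lee_fin sqr_ge0.
have mY m : measurable_fun setT (fun w => (Y m w)%:E).
  by apply/measurable_EFinP; have [] := bY m.
have fin : (\int[P]_w \sum_(0 <= m <oo) (Y m w)%:E <= 2%:E)%E.
  rewrite integral_nneseries//.
  apply: lime_le; first by apply: is_cvg_nneseries => m _ _; exact: integral_ge0.
  near=> n; rewrite (eq_bigr (fun m => (Ex P (Y m))%:E)); last by move=> m _; exact: EY.
  rewrite sumEFin lee_fin.
  apply: (@le_trans _ _ (\sum_(0 <= m < n) 2 * (m.+1%:R^-1 - m.+2%:R^-1))).
    by apply: ler_sum => m _; exact: Ex_Y.
  rewrite -mulr_sumr -[leRHS]mulr1 ler_pM2l//.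
  elim: (n) => [|q _]; first by rewrite big_nil.
  rewrite (eq_bigr (fun m => - m.+2%:R^-1 - - m.+1%:R^-1)); last by move=> i _; ring.
  rewrite (telescope_sumr (fun m => - m.+1%:R^-1))// opprK.
  by rewrite [1%:R^-1]invr1 addrC gerDl oppr_le0.
have intY : P.-integrable setT (fun w => \sum_(0 <= m <oo) (Y m w)%:E)%E.
  apply/integrableP; split; first exact: ge0_emeasurable_sum.
  under eq_integral do rewrite gee0_abs ?nneseries_ge0//.
  exact: le_lt_trans fin (ltry _).
apply: filterS (integrable_ae measurableT intY) => w /(_ I) finw e e0.
have ltw : (\sum_(0 <= m <oo) (Y m w)%:E < +oo)%E.
  by move: finw; rewrite fin_numE => /andP[_]; rewrite lt_neqAle leey andbT.
have Yw0 (r : R) : 0 < r -> \forall m \near \oo, Y m w <= r.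
  move=> r0; have := nneseries_tail_cvg ltw (fun m _ => Y0 m w).
  move=> /fine_cvgP[fint /cvgr0Pnorm_le /(_ r r0)].
  move=> rt; near=> m; rewrite -lee_fin.
  have ftm : (\sum_(m <= k <oo) (Y k w)%:E)%E \is a fin_num by near: m.
  apply: (@le_trans _ _ (\sum_(m <= k <oo) (Y k w)%:E)%E).
    rewrite (@nneseries_split_cond _ _ m 1)//.
    rewrite /= addn1 big_nat_recl//= big_geq//= adde0 leeDl//.
    by apply: nneseries_ge0 => *.
  rewrite -(fineK ftm) lee_fin; apply: le_trans (ler_norm _) _.
  by near: m.
apply: cvg_freq_of_squares => //.
  move=> m n mn; rewrite /S -(big_mkord xpredT (fun i => \1_(A i) w)).
  rewrite -(big_mkord xpredT (fun i => \1_(A i) w)) [leRHS](big_cat_nat (leq0n m) mn)/= lerDl.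
  by apply: sumr_ge0.
move=> r r0; have [N _ HN] := Yw0 _ (exprn_gt0 2 r0).
(* [Y m] concerns the square of [m.+1], so the threshold moves by one. *)
exists N.+1 => // -[//|m] /= Nm; have := ler_wsqrtr (HN m Nm).
rewrite /Y !sqrtr_sqr (gtr0_norm r0) normrM.
rewrite normfV ler_pdivrMr ?normr_gt0 ?pnatr_eq0 ?expn_eq0//.
by rewrite (@ger0_norm _ (_ %:R)).
Unshelve. all: by end_near. Qed.

End PairwiseLLN.

(** * Borel subsets of R^d and finite covers by balls *)

Section BorelRow.
Context {R : realType} {d : nat}.
Local Notation V := 'rV[R]_d.
Local Notation bT := (g_sigma_algebraType [set A : set V | open A]).
Implicit Types A B : set V.

Lemma borel_open A : open A -> borel_rV A.
Proof. by move=> oA; apply: sub_sigma_algebra. Qed.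

Lemma borelC A : borel_rV A -> borel_rV (~` A).
Proof. exact: (@measurableC _ bT). Qed.

Lemma borel_closed A : closed A -> borel_rV A.
Proof.
by move=> cA; rewrite -[A]setCK; apply: borelC; apply: borel_open; exact: closed_openC.
Qed.

Lemma borelI A B : borel_rV A -> borel_rV B -> borel_rV (A `&` B).
Proof. exact: (@measurableI _ bT). Qed.

Lemma borelU A B : borel_rV A -> borel_rV B -> borel_rV (A `|` B).
Proof. exact: (@measurableU _ bT). Qed.

Lemma borelT : borel_rV (setT : set V).
Proof. by apply: borel_open; exact: openT. Qed.

Lemma closed_superlevel (f : V -> R) (s : R) : continuous f -> closed [set x | s <= f x].
Proof.
move=> cf; rewrite (_ : [set x | _] = f @^-1` [set y | s <= y])//.
by apply: (closed_comp (fun x _ => cf x)); exact: closed_ge.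
Qed.

Lemma closed_sublevel (f : V -> R) (s : R) : continuous f -> closed [set x | f x <= s].
Proof.
move=> cf; rewrite (_ : [set x | _] = f @^-1` [set y | y <= s])//.
by apply: (closed_comp (fun x _ => cf x)); exact: closed_le.
Qed.

Lemma borel_lev_ab (f : V -> R) a b : continuous f -> borel_rV (lev_ab f a b).
Proof.
move=> cf; rewrite (_ : lev_ab f a b = [set x | a <= f x] `&` [set x | f x <= b]).
  by apply: borelI; apply: borel_closed; [exact: closed_superlevel|exact: closed_sublevel].
by apply/seteqP; split=> x /=; [move=> /andP[]|move=> [h1 h2]; apply/andP].
Qed.

Lemma compact_ball_cover (K : set V) (r : V -> R) : compact K ->
  (forall x, K x -> 0 < r x) ->
  exists2 s : seq V, (forall x, x \in s -> K x) &
    forall y, K y -> exists2 x, x \in s & ball x (r x) y.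
Proof.
rewrite compact_cover => cK r0.
have [x Kx| |s sK Ks] := cK V K (fun x => ball x (r x)).
- by apply: ball_open; exact: r0.
- by move=> y Ky; exists y => //; apply: ballxx; exact: r0.
exists (finmap.enum_fset s); first by move=> x /sK; rewrite inE.
by move=> y /Ks[x /= xs yx]; exists x.
Qed.

End BorelRow.

(** * From the density to masses of cubes *)

Section DensityOnBoxes.
Context {R : realType}.

(** The integral of a nonnegative function is a supremum over simple functions below it, hence
    monotone for arbitrary integrands. It is applied to the inner iterated integrals, whose
    measurability is never established. *)
Lemma ge0_integral_mono d (T : measurableType d) (mu : {measure set T -> \bar R})
    (D : set T) (f1 f2 : T -> \bar R) :
  (forall x, D x -> (0 <= f1 x)%E) -> (forall x, D x -> (f1 x <= f2 x)%E) ->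
  (\int[mu]_(x in D) f1 x <= \int[mu]_(x in D) f2 x)%E.
Proof.
move=> f10 f12; rewrite !ge0_integralE//; last first.
  by move=> x Dx; exact: le_trans (f10 x Dx) (f12 x Dx).
apply: ge_ereal_sup => _ /= [h hf <-]; apply: ereal_sup_ubound; exists h => //= x.
by apply: le_trans (hf x) _; rewrite !patchE; case: ifPn => // /set_mem; exact: f12.
Qed.

(** Induction on the number of integrated coordinates. The bounds on [F] concern only points that
    agree with [x] from coordinate [k] on, as the recursion of [iint] freezes these. *)
Lemma iint_bounds (k : nat) (a b : nat -> R) (F : (nat -> R) -> R) (x : nat -> R)
    (c M : R) : 0 <= c -> (forall i, a i <= b i) ->
  (forall y, (forall j, (j < k)%N -> a j <= y j <= b j) ->
     (forall j, (k <= j)%N -> y j = x j) -> c <= F y <= M) ->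
  ((c * \prod_(i < k) (b i - a i))%:E <= iint k a b F x)%E /\
  (iint k a b F x <= (M * \prod_(i < k) (b i - a i))%:E)%E.
Proof.
move=> c0 ab; elim: k x => [|k ih] x HF /=.
  by rewrite big_ord0 !mulr1 !lee_fin; apply/andP; exact: HF.
have {}ih s : a k <= s <= b k ->
  ((c * \prod_(i < k) (b i - a i))%:E <=
     iint k a b F (fun j => if j == k then s else x j))%E /\
  (iint k a b F (fun j => if j == k then s else x j) <=
     (M * \prod_(i < k) (b i - a i))%:E)%E.
  move=> sk; apply: ih => y yk yx; apply: HF => j jk.
    have [->|jnk] := eqVneq j k; first by rewrite yx ?eqxx.
    by apply: yk; rewrite ltn_neqAle jnk -ltnS.
  by rewrite yx ?(ltnW jk)// gtn_eqF.
have prod0 : 0 <= \prod_(i < k) (b i - a i).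
  by apply: prodr_ge0 => i _; rewrite subr_ge0.
have cst_int (q : R) : (\int[@lebesgue_measure R]_(s in `[a k, b k]) q%:E =
    (q * (b k - a k))%:E)%E.
  rewrite integral_cst//= lebesgue_measure_itv/= lte_fin.
  have [abk|] := ltP (a k) (b k); first by rewrite -EFinD -EFinM.
  by move=> bak; rewrite mule0 (@le_anti _ _ (a k) (b k)) ?ab// subrr mulr0.
rewrite big_ord_recr/= !mulrA -!cst_int; split; apply: ge0_integral_mono => s /=;
  rewrite in_itv/= => sk.
- by rewrite lee_fin mulr_ge0.
- by have [] := ih _ sk.
- have [h _] := ih _ sk; apply: le_trans h; by rewrite lee_fin mulr_ge0.
- by have [] := ih _ sk.
Qed.

Context {d : nat}.
Local Notation V := 'rV[R]_d.

Definition cube (z : V) (e : R) : set V :=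
  [set x | forall i, z ord0 i <= x ord0 i <= z ord0 i + e].

Lemma closed_cube z e : closed (cube z e).
Proof.
rewrite (_ : cube z e = \bigcap_(i in [set: 'I_d])
    ([set x | z ord0 i <= x ord0 i] `&` [set x | x ord0 i <= z ord0 i + e])).
  have cc i : continuous (fun x : V => x ord0 i).
    by move=> x; apply: coord_continuous.
  by apply: closed_bigI => i _; apply: closedI; [exact: closed_superlevel|exact: closed_sublevel].
apply/seteqP; split=> x /= xc i; first by move=> _; apply/andP; exact: xc.
by have [] := xc i I => -> ->.
Qed.

Lemma borel_cube z e : borel_rV (cube z e).
Proof. by apply: borel_closed; exact: closed_cube. Qed.

Context {dT : measure_display} {T : measurableType dT}.
Variables (P : probability T R) (X0 : T -> V) (f : V -> R).
Hypothesis density : forall a b : nat -> R,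
  P (X0 @^-1` box a b) = box_integral a b f.

(** The density hypothesis is unfolded only here; every later estimate on masses goes through cubes
    on which [f] is bounded on both sides. *)
Lemma cube_prob (z : V) (e c M : R) : 0 <= e -> 0 <= c ->
  (forall x, cube z e x -> c <= f x <= M) ->
  c * e ^+ d <= fine (P (X0 @^-1` cube z e)) <= M * e ^+ d.
Proof.
move=> e0 c0 fcM; pose a j : R := oapp (fun i => z ord0 i) 0 (insub j).
have aE (i : 'I_d) : a i = z ord0 i by rewrite /a valK.
have -> : cube z e = box a (fun j => a j + e).
  by apply/seteqP; split=> x /= xc i; have := xc i; rewrite aE.
rewrite density /box_integral.
have [|||lo hi] := @iint_bounds d a (fun j => a j + e)
  (fun x => f (\row_i x (nat_of_ord i))) (fun=> 0) c M => //.
- by move=> i; rewrite lerDl.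
- by move=> y ya _; apply: fcM => i; rewrite mxE -aE; exact: ya.
have volE : \prod_(i < d) (a i + e - a i) = e ^+ d.
  rewrite (eq_bigr (fun=> e)); last by move=> i _; rewrite addrC addKr.
  by rewrite prodr_const card_ord.
rewrite -volE -!lee_fin fineK ?lo ?hi//.
rewrite fin_numE gt_eqF ?(lt_le_trans _ lo) ?ltNyr//=.
by rewrite lt_eqF// (le_lt_trans hi) ?ltry.
Qed.

End DensityOnBoxes.

Lemma sum_indic_disjoint_le1 (R : realType) (T : Type) (I : finType) (H : pred I)
    (E : I -> set T) (w : T) :
  (forall i j, H i -> H j -> E i w -> E j w -> i = j) ->
  \sum_(i | H i) \1_(E i) w <= 1 :> R.
Proof.
move=> dE; have [[i /andP[Hi Ei]]|noE] := pselect (exists i, H i && (w \in E i)).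
  rewrite (bigD1 i)//= big1 ?addr0; first by rewrite indicE Ei.
  move=> j /andP[Hj ji]; rewrite indicE; case: (boolP (w \in E j)) => // Ej.
  by rewrite (dE i j Hi Hj (set_mem Ei) (set_mem Ej)) eqxx in ji.
rewrite big1// => i Hi; rewrite indicE; case: (boolP (w \in E i)) => // Ei.
by exfalso; apply: noE; exists i; rewrite Hi.
Qed.

(** * Nullity of the level set and positivity of mass above it *)

Section LevelSetNull.
Context {R : realType} {d : nat} {dT : measure_display} {T : measurableType dT}.
Local Notation V := 'rV[R]_d.
Variables (P : probability T R) (X0 : T -> V) (f : V -> R) (t K M : R).
Hypothesis mX0 : forall A, borel_rV A -> measurable (X0 @^-1` A).
Hypothesis density : forall a b : nat -> R,
  P (X0 @^-1` box a b) = box_integral a b f.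
Hypothesis df : forall x, differentiable f x.
Hypothesis cdf : forall i, continuous (partial f i).
Hypothesis lipf : forall x y, `|f y - f x| <= K * `|y - x|.
Hypothesis fM : forall x, f x <= M.
Hypothesis t0 : 0 < t.

Let cf : continuous f.
Proof. by move=> x; apply: differentiable_continuous; exact: df. Qed.

Let borel_level : borel_rV [set x | f x = t].
Proof.
rewrite (_ : [set x | f x = t] = [set x | t <= f x] `&` [set x | f x <= t]).
  by apply: borelI; apply: borel_closed; [exact: closed_superlevel|exact: closed_sublevel].
apply/seteqP; split=> x /=; first by move=> ->.
by move=> [h1 h2]; apply/le_anti/andP.
Qed.

(** With [HL] hit cells of side [e], the level set has mass at most [HL * M * e^d], while
    [HL * (L + 1)] disjoint cells of side [e / 2] on which [f >= t / 2] have total mass at most [1].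
    Eliminating [HL] also eliminates the mesh [e], which leaves [M * 2^(d+1) / (t * (L + 1))]. *)
Lemma level_grid_bound (x0 : V) (i0 : 'I_d) (r cc sg : R) (L : nat) :
  0 < r -> 0 < cc -> sg ^+ 2 = 1 -> 0 <= K ->
  (forall z, ball x0 (4 * r) z -> cc <= sg * partial f i0 z) ->
  (forall z, ball x0 (4 * r) z -> t / 2 <= f z) ->
  fine (P (X0 @^-1` ([set x | f x = t] `&` ball x0 r)))
    <= M * 2 ^+ d.+1 / (t * L.+1%:R).
Proof.
move=> r0 cc0 sg1 K0 pf ft.
have L0 : 0 < L.+1%:R :> R by [].
(* The mesh is chosen for [eK]: [f] varies by at most [2 * K * e] between points of two hit cells,
   whereas along the [i0] axis two distinct shifts change it by at least [cc * r / (L + 1)]. *)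
pose N := (Num.truncn (4 * K * L.+1%:R / cc)).+1.
have N0 : 0 < N%:R :> R by [].
pose e : R := 2 * r / N%:R.
have e0 : 0 < e by rewrite divr_gt0// mulr_gt0.
have eN : e * N%:R = 2 * r by rewrite /e divfK// gt_eqF.
have eK : 2 * K * e < cc * (r / L.+1%:R).
  have : 4 * K * L.+1%:R / cc < N%:R by exact: truncnS_gt.
  rewrite ltr_pdivrMr// => h.
  rewrite mulrA ltr_pdivlMr// /e mulrA mulrAC ltr_pdivrMr//.
  by have := mulr_gt0 r0 N0; nra.
pose z (q : {ffun 'I_d -> 'I_N}) : V := \row_i (x0 ord0 i - r + e * (q i)%:R).
have zE q i : z q ord0 i = x0 ord0 i - r + e * (q i)%:R by rewrite mxE.
pose sh (l : 'I_L.+1) : R := r * l%:R / L.+1%:R.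
have sh0 l : 0 <= sh l by rewrite /sh divr_ge0// mulr_ge0// ltW.
have sh1 l : sh l <= r.
  by rewrite /sh ler_pdivrMr// ler_pM2l// ler_nat ltnW.
have zb q i : x0 ord0 i - r <= z q ord0 i <= x0 ord0 i + r - e.
  rewrite zE lerDl mulr_ge0//=; last exact: ltW.
  have : e * (q i)%:R + e <= e * N%:R.
    by rewrite -{2}[e]mulr1 -mulrDr ler_pM2l// natr1 ler_nat.
  by rewrite eN; lra.
pose hit q := `[< exists2 x, cube (z q) e x & f x = t >].
(* The cells meeting {f = t}, shifted along the i0-th axis by the multiples of
   r / (L+1) and shrunk by one half, are pairwise disjoint since f is strictly
   monotone in that direction; so L+1 copies of the hit volume fit in mass 1. *)
pose E (ql : {ffun 'I_d -> 'I_N} * 'I_L.+1) : set V :=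
  cube (z ql.1 + sh ql.2 *: evec R i0) (e / 2).
have shE q l i : (z q + sh l *: evec R i0) ord0 i =
    z q ord0 i + sh l * (i == i0)%:R by rewrite !mxE.
have ball4 (x : V) : (forall i, x0 ord0 i - r <= x ord0 i <= x0 ord0 i + 2 * r) ->
    ball x0 (4 * r) x.
  move=> xb; rewrite -ball_normE /=; apply: norm_lt_coord => [|i]; first by lra.
  by have := xb i; rewrite !mxE ltr_norml => /andP[? ?]; apply/andP; split; lra.
have Eball ql x : E ql x -> ball x0 (4 * r) x.
  move=> Ex; apply: ball4 => i.
  have := Ex i; have := zb ql.1 i; have := sh0 ql.2; have := sh1 ql.2; rewrite shE.
  move=> s1 s0 /andP[z1 z2]; case: (i == i0); rewrite ?mulr1 ?mulr0 => /andP[x1 x2].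
    by apply/andP; split; lra.
  by apply/andP; split; lra.
have cball q x : cube (z q) e x -> ball x0 (4 * r) x.
  move=> Ex; apply: ball4 => i; have := Ex i; have := zb q i.
  by move=> /andP[z1 z2] /andP[x1 x2]; apply/andP; split; lra.
have Eback ql x : E ql x -> cube (z ql.1) (e / 2) (x - sh ql.2 *: evec R i0).
  move=> Ex i; have := Ex i; rewrite shE !mxE eqxx/=.
  by move=> /andP[h1 h2]; apply/andP; split; lra.
have cube2 q x : cube (z q) (e / 2) x -> cube (z q) e x.
  by move=> xc i; have /andP[h1 h2] := xc i; apply/andP; split; lra.
have near_t q x : hit q -> cube (z q) e x -> `|f x - t| <= K * e.
  move=> /asboolP[y yc <-] xc; rewrite (le_trans (lipf y x))// ler_wpM2l//.
  apply: norm_le_coord => [|i]; first exact: ltW.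
  have := xc i; have := yc i; rewrite !mxE ler_norml.
  by move=> /andP[h1 h2] /andP[h3 h4]; apply/andP; split; lra.
have disj ql ql' x : hit ql.1 -> hit ql'.1 -> E ql x -> E ql' x -> ql = ql'.
  case: ql ql' => [q l] [q' l'] /= hq hq' Ex Ex'.
  have /= u := Eback _ _ Ex; have /= u' := Eback _ _ Ex'.
  (* For equal shifts the halving matters: closed cells of full side would share faces with their
     neighbours. *)
  have [ll'|ll'] := eqVneq l l'.
    congr pair => //; apply/ffunP => i; apply/val_inj/eqP.
    move: u'; rewrite -ll' => u'.
    have := u i; have := u' i; move: ((x - _) ord0 i) => y.
    rewrite !zE => /andP[h1 h2] /andP[h3 h4].
    have h5 : (q i)%:R < (q' i)%:R + 1 :> R by rewrite -(ltr_pM2l e0); lra.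
    have h6 : (q' i)%:R < (q i)%:R + 1 :> R by rewrite -(ltr_pM2l e0); lra.
    move: h5 h6; rewrite !natr1 !ltr_nat !ltnS => h5 h6.
    by rewrite eqn_leq h5 h6.
  (* For distinct shifts, undoing them gives two points of hit cells that differ along the [i0] axis
     alone; the mean value theorem and [near_t] then contradict [eK]. *)
  exfalso; set v := x - _ in u; set v' := x - _ in u'.
  have bv := cball _ _ (cube2 _ _ u); have bv' := cball _ _ (cube2 _ _ u').
  have [|s s01 fvv'] := @segment_MVT _ _ f v v'; first by move=> *; exact: df.
  have vv' : v' - v = (sh l - sh l') *: evec R i0.
    by rewrite /v /v'; apply/rowP => i; rewrite !mxE; ring.
  move: fvv'; rewrite (bigD1 i0)//= big1 ?addr0; last first.
    by move=> i ii0; rewrite {1}vv' !mxE (negbTE ii0) andbF mulr0 mul0r.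
  rewrite {1}vv' !mxE !eqxx mulr1 => fvv'.
  have := pf _ (ball_segment bv bv' s01).
  have n1 := near_t _ _ hq (cube2 _ _ u); have n2 := near_t _ _ hq' (cube2 _ _ u').
  set D := partial f i0 _ in fvv' * => Dcc.
  have ffv : `|f v' - f v| <= 2 * K * e.
    have -> : f v' - f v = (f v' - t) - (f v - t) by ring.
    by rewrite (le_trans (ler_normB _ _))//; lra.
  have shll : r / L.+1%:R <= `|sh l - sh l'|.
    rewrite /sh -mulrBl -mulrBr normrM normfV (gtr0_norm L0) ler_pM2r ?invr_gt0//.
    rewrite normrM (gtr0_norm r0) -{1}[r]mulr1 ler_pM2l//.
    have [ltl|ltl|/eqP] := ltgtP (l : nat) l'; last by rewrite (inj_eq val_inj) (negbTE ll').
      rewrite distrC ger0_norm ?subr_ge0 ?ler_nat ?(ltnW ltl)//.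
      by rewrite lerBrDr addrC natr1 ler_nat.
    rewrite ger0_norm ?subr_ge0 ?ler_nat ?(ltnW ltl)//.
    by rewrite lerBrDr addrC natr1 ler_nat.
  have absD : cc <= `|D|.
    rewrite (le_trans Dcc)// (le_trans (ler_norm _))// normrM.
    suff -> : `|sg| = 1 by rewrite mul1r.
    by apply/eqP; rewrite -sqrp_eq1// real_normK ?num_real// sg1.
  move: ffv; rewrite fvv' normrM leNgt => /negP; apply.
  apply: (lt_le_trans eK); rewrite mulrC ler_pM//; last exact: ltW.
  by rewrite divr_ge0// ltW.
have mE ql : measurable (X0 @^-1` E ql) by apply: mX0; exact: borel_cube.
have bE ql := bounded_rv_indic (R := R) (mE ql).
have mc q : measurable (X0 @^-1` cube (z q) e) by apply: mX0; exact: borel_cube.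
have bc q := bounded_rv_indic (R := R) (mc q).
pose HL := #|[pred q | hit q]|.
have e20 : 0 <= e / 2 by rewrite divr_ge0// ltW.
have t20 : 0 <= t / 2 by rewrite divr_ge0// ltW.
have cE ql : t / 2 * (e / 2) ^+ d <= fine (P (X0 @^-1` E ql)).
  have fb x : E ql x -> t / 2 <= f x <= M.
    by move=> Ex; rewrite fM andbT; apply: ft; exact: (Eball ql).
  by have /andP[] := cube_prob density e20 t20 fb.
have cc' q : fine (P (X0 @^-1` cube (z q) e)) <= M * e ^+ d.
  have fb x : cube (z q) e x -> t / 2 <= f x <= M.
    by move=> xc; rewrite fM andbT; apply: ft; exact: (cball q).
  by have /andP[] := cube_prob density (ltW e0) t20 fb.
have mass1 : HL%:R * L.+1%:R * (t / 2 * (e / 2) ^+ d) <= 1.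
  rewrite -[leRHS](Ex_cst P 1).
  apply: (@le_trans _ _ (\sum_(ql <- [seq ql <- enum {: {ffun 'I_d -> 'I_N} * 'I_L.+1}
      | hit ql.1]) Ex P (\1_(X0 @^-1` E ql)))).
    rewrite big_filter big_enum_cond/=.
    apply: (@le_trans _ _ (\sum_(ql : {ffun 'I_d -> 'I_N} * 'I_L.+1 | hit ql.1)
        (t / 2 * (e / 2) ^+ d))).
      rewrite (eq_bigl (fun ql => hit ql.1 && true)); last by move=> ql; rewrite andbT.
      rewrite -(pair_big_dep hit (fun _ _ => true) (fun _ _ => t / 2 * (e / 2) ^+ d))/=.
      rewrite sumr_const sumr_const card_ord.
      by rewrite -mulrnA -[leRHS]mulr_natl natrM [X in _ <= X * _]mulrC; exact: lexx.
    by apply: ler_sum => ql _; rewrite Ex_indic.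
  rewrite -Ex_sum//; apply: Ex_le; [exact: bounded_rv_sum|exact: bounded_rv_cst|].
  move=> w; rewrite big_filter big_enum_cond/=; apply: sum_indic_disjoint_le1.
  by move=> ql ql' hq hq' /=; exact: disj.
have mS : measurable (X0 @^-1` ([set x | f x = t] `&` ball x0 r)).
  by apply: mX0; apply: borelI => //; apply: borel_open; exact: ball_open.
have cover : fine (P (X0 @^-1` ([set x | f x = t] `&` ball x0 r)))
    <= HL%:R * (M * e ^+ d).
  rewrite -Ex_indic//.
  apply: (@le_trans _ _ (\sum_(q <- [seq q <- enum {ffun 'I_d -> 'I_N} | hit q])
      Ex P (\1_(X0 @^-1` cube (z q) e)))); last first.
    rewrite big_filter big_enum_cond/=.
    apply: (@le_trans _ _ (\sum_(q | hit q) (M * e ^+ d))).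
      by apply: ler_sum => q _; rewrite Ex_indic.
    by rewrite sumr_const -[leLHS]mulr_natl.
  rewrite -Ex_sum//; apply: Ex_le; [exact: bounded_rv_indic|exact: bounded_rv_sum|].
  move=> w; rewrite big_filter big_enum_cond/= indicE.
  case: (boolP (w \in _)) => [/set_mem [/= fw xw]|_]; last exact: sumr_ge0.
  (* The ball is open, so each coordinate stays strictly below the end of the grid and the truncated
     quotient is a valid cell index. *)
  have rN i : (Num.truncn ((X0 w ord0 i - x0 ord0 i + r) / e) < N)%N /\
      e * (Num.truncn ((X0 w ord0 i - x0 ord0 i + r) / e))%:R
        <= X0 w ord0 i - x0 ord0 i + r
        <= e * (Num.truncn ((X0 w ord0 i - x0 ord0 i + r) / e))%:R + e.
    have : `|(x0 - X0 w) ord0 i| < r.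
      by rewrite (le_lt_trans (coord_le_norm _ _))//; move: xw; rewrite -ball_normE.
    rewrite !mxE ltr_norml => /andP[h1 h2].
    set y := X0 w ord0 i - x0 ord0 i + r.
    have y0 : 0 <= y / e by rewrite divr_ge0//; [rewrite /y; lra|exact: ltW].
    have /andP[t1 t2] := truncn_itv y0.
    have t1' : e * (Num.truncn (y / e))%:R <= y.
      by rewrite mulrC -ler_pdivlMr.
    split.
      rewrite -(ltr_nat R) -(ltr_pM2l e0) eN (le_lt_trans t1')// /y; lra.
    rewrite t1'/=.
    move: t2; rewrite ltr_pdivrMr// -natr1 mulrDl mul1r mulrC => /ltW; exact.
  pose q : {ffun 'I_d -> 'I_N} := [ffun i => Ordinal (rN i).1].
  have qc : cube (z q) e (X0 w).
    move=> i; rewrite zE ffunE /=; have [_ /andP[h1 h2]] := rN i.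
    by apply/andP; split; lra.
  have hq : hit q by apply/asboolP; exists (X0 w).
  rewrite (bigD1 q)//= indicE mem_set// lerDl; exact: sumr_ge0.
apply: (le_trans cover).
have M0 : 0 <= M.
  have h := ft _ (ballxx x0 (_ : 0 < 4 * r)); have := fM x0; have := h; lra.
have e2 : e ^+ d = 2 ^+ d * (e / 2) ^+ d.
  by rewrite -exprMn mulrCA divff ?mulr1// pnatr_eq0.
rewrite e2 ler_pdivlMr ?mulr_gt0//.
have -> : HL%:R * (M * (2 ^+ d * (e / 2) ^+ d)) * (t * L.+1%:R) =
    M * 2 ^+ d.+1 * (HL%:R * L.+1%:R * (t / 2 * (e / 2) ^+ d)).
  by rewrite [2 ^+ d.+1]exprS; field.
by rewrite -[leRHS]mulr1 ler_wpM2l// mulr_ge0// exprn_ge0.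
Qed.


Hypothesis K0 : 0 <= K.

(** The grid bound holds for every [L], hence lies below any [e > 0]. The sign [sg] makes the chosen
    derivative positive, and [r = rho / 4] because the grid argument works in the ball of radius
    [4 * r]. *)
Lemma level_locally_null x0 : f x0 = t -> (exists i, partial f i x0 != 0) ->
  exists2 r : R, 0 < r & fine (P (X0 @^-1` ([set x | f x = t] `&` ball x0 r))) <= 0.
Proof.
move=> fx0 [i0 pi0]; pose sg := Num.sg (partial f i0 x0).
pose cc := `|partial f i0 x0| / 2.
have cc0 : 0 < cc by rewrite divr_gt0// normr_gt0.
have ccn : \forall z \near x0, cc < sg * partial f i0 z.
  have : sg * partial f i0 z @[z --> x0] --> sg * partial f i0 x0.
    by apply: (@cvgM _ _ (nbhs x0) _ (fun=> sg) (partial f i0)); [exact: cvg_cst|exact: cdf].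
  move/cvgr_gt; apply; rewrite -normrEsg /cc.
  by rewrite ltr_pdivrMr// mulr_natr mulr2n ltrDl normr_gt0.
have ftn : \forall z \near x0, t / 2 < f z.
  have /cvgr_gt : f z @[z --> x0] --> f x0 by exact: cf.
  by apply; rewrite fx0 ltr_pdivrMr// mulr_natr mulr2n ltrDl.
have /nbhs_ballP[rho /= rho0 hrho] : \forall z \near x0,
    cc < sg * partial f i0 z /\ t / 2 < f z by near do split.
pose r := rho / 4.
have r0 : 0 < r by rewrite divr_gt0.
have r4 : 4 * r = rho by rewrite /r; field.
exists r => //; apply/ler_addgt0Pr => e e0; rewrite add0r.
set C := M * 2 ^+ d.+1 / t.
pose L := Num.truncn (C / e).
have : fine (P (X0 @^-1` ([set x | f x = t] `&` ball x0 r))) <=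
    M * 2 ^+ d.+1 / (t * L.+1%:R).
  apply: (@level_grid_bound x0 i0 r cc sg L) => //.
  - by rewrite /sg sqr_sg pi0.
  - by move=> z; rewrite r4 => /hrho[/ltW].
  - by move=> z; rewrite r4 => /hrho[_ /ltW].
move/le_trans; apply; rewrite invfM mulrA -/C ler_pdivrMr// mulrC -ler_pdivrMr//.
exact/ltW/truncnS_gt.
Unshelve. all: by end_near. Qed.

Lemma level_null : (forall x, f x = t -> exists i, partial f i x != 0) ->
  compact [set x | t <= f x] -> P (X0 @^-1` [set x | f x = t]) = 0%E.
Proof.
move=> pf cL; have cl : compact [set x | f x = t].
  have -> : [set x | f x = t] = [set x | f x <= t] `&` [set x | t <= f x].
    apply/seteqP; split=> x /=; first by move=> ->.
    by move=> [h1 h2]; apply/le_anti/andP.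
  apply: (subclosed_compact _ cL) => [|x []//].
  by apply: closedI; [exact: closed_sublevel|exact: closed_superlevel].
have /choice[r hr] : forall x, exists r : R, f x = t -> 0 < r /\
    fine (P (X0 @^-1` ([set x | f x = t] `&` ball x r))) <= 0.
  move=> x; have [fx|] := pselect (f x = t); last by exists 0.
  by have [r] := level_locally_null fx (pf x fx); exists r.
have [|s sl cs] := @compact_ball_cover _ _ [set x | f x = t] r cl.
  by move=> x /= fx; have [] := hr x fx.
have ml : measurable (X0 @^-1` [set x | f x = t]) by exact: mX0.
(* The empty set off the level makes [B x] measurable after pull-back for every [x], as linearity of
   [Ex] over the list of centres requires. *)
pose B x : set V := if f x == t then [set x | f x = t] `&` ball x (r x) else set0.
have mB x : measurable (X0 @^-1` B x).
  rewrite /B; case: eqP => fx; last by rewrite preimage_set0.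
  have [rx0 _] := hr x fx.
  by apply: mX0; apply: borelI => //; apply: borel_open; exact: ball_open.
have bB x := bounded_rv_indic (R := R) (mB x).
have le0 : fine (P (X0 @^-1` [set x | f x = t])) <= 0.
  rewrite -Ex_indic//; apply: (@le_trans _ _ (\sum_(x <- s) Ex P (\1_(X0 @^-1` B x)))).
    rewrite -Ex_sum//; apply: Ex_le; [exact: bounded_rv_indic|exact: bounded_rv_sum|].
    move=> w; rewrite [leLHS]indicE; case: (boolP (w \in _)) => [/set_mem /= fw|_].
      have [x xs xw] := cs _ fw; rewrite (big_rem x)//= indicE mem_set ?lerDl ?sumr_ge0//.
      by rewrite /preimage /B/= (sl x xs) eqxx.
    by apply: sumr_ge0.
  rewrite big_seq; apply: sumr_le0 => x /sl /= fx; rewrite Ex_indic// /B fx eqxx.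
  by have [] := hr x fx.
apply/eqP; rewrite eq_le measure_ge0 andbT -(fineK (fin_num_measure P _ ml)) lee_fin.
exact: le0.
Qed.

(** Continuity of [P] from above along bands of half-width [1 / (m + 1)], which decrease to the null
    set [{f = t}]. *)
Lemma small_band : (forall x, f x = t -> exists i, partial f i x != 0) ->
  compact [set x | t <= f x] ->
  forall eta : R, 0 < eta -> exists2 e : R, 0 < e &
    fine (P (X0 @^-1` lev_ab f (t - e) (t + e))) <= eta.
Proof.
move=> pf cL eta eta0; pose F (m : nat) := X0 @^-1` lev_ab f (t - m.+1%:R^-1) (t + m.+1%:R^-1).
have mF m : measurable (F m) by apply: mX0; exact: borel_lev_ab.
have capF : \bigcap_n F n = X0 @^-1` [set x | f x = t].
  apply/seteqP; split=> w /=; last first.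
    move=> fw m _; rewrite /F /lev_ab /preimage /=; move: fw; rewrite /preimage/= => ->.
    by rewrite gerBl lerDl invr_ge0 ler0n.
  move=> Fw; apply/eqP; rewrite -subr_eq0 -normr_le0; apply/ler_addgt0Pr => e e0.
  rewrite add0r; have := Fw (Num.truncn e^-1) I; rewrite /F /preimage /lev_ab /=.
  move=> hw; apply: (@le_trans _ _ (Num.truncn e^-1).+1%:R^-1).
    by rewrite ler_distl.
  by rewrite -[leRHS]invrK lef_pV2 ?posrE ?invr_gt0//; exact/ltW/truncnS_gt.
have cvF : (P \o F) x @[x --> \oo] --> P (\bigcap_n F n).
  apply: nonincreasing_cvg_mu => //.
  - by rewrite (le_lt_trans (probability_le1 P (mF 0%N))) ?ltry.
  - by rewrite capF; exact: mX0.
  - move=> m n mn; apply/subsetPset => w; rewrite /F /preimage /lev_ab /= => /andP[h1 h2].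
    have : n.+1%:R^-1 <= m.+1%:R^-1 :> R by rewrite lef_pV2 ?posrE// ler_nat.
    by move=> h; rewrite (le_trans _ h1) ?(le_trans h2)// ?lerB ?lerD.
move: cvF; rewrite capF level_null// => /fine_cvgP[_ /cvgr0Pnorm_le /(_ eta eta0)].
case=> m _ /(_ m (leqnn m)) /= Hm; exists m.+1%:R^-1; first by rewrite invr_gt0.
exact: le_trans (ler_norm _) Hm.
Qed.

(** A small cube with lower corner [y] stays where [f > t], so its mass is at least [t] times its
    volume. *)
Lemma superlevel_ball_pos y r : t < f y -> 0 < r ->
  0 < fine (P (X0 @^-1` ([set x | t <= f x] `&` ball y r))).
Proof.
move=> fy r0.
have : \forall z \near y, t < f z /\ ball y r z.
  near do split; last exact: nbhsx_ballx.
  by have /cvgr_gt : f z @[z --> y] --> f y by [exact: cf]; apply.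
move=> /nbhs_ballP[rho /= rho0 hrho]; pose e := rho / 2.
have e0 : 0 < e by rewrite divr_gt0.
have cb x : cube y e x -> ball y rho x.
  move=> xc; rewrite -ball_normE /=; apply: norm_lt_coord => // i.
  have /andP[h1 h2] := xc i; rewrite !mxE ltr_norml; move: h2; rewrite /e => h2.
  by apply/andP; split; lra.
have fb x : cube y e x -> t <= f x <= M.
  by move=> /cb/hrho[/ltW ? _]; apply/andP.
have /andP[lo _] := cube_prob density (ltW e0) (ltW t0) fb.
have mc : measurable (X0 @^-1` cube y e) by apply: mX0; exact: borel_cube.
have mb : measurable (X0 @^-1` ([set x | t <= f x] `&` ball y r)).
  apply: mX0; apply: borelI; first by apply: borel_closed; exact: closed_superlevel.
  by apply: borel_open; exact: ball_open.
apply: (lt_le_trans _ (le_trans lo _)); first by rewrite mulr_gt0// exprn_gt0.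
rewrite fine_le ?fin_num_measure// le_measure ?inE// => w /cb /hrho[/ltW ? ?].
by split.
Unshelve. all: by end_near. Qed.

End LevelSetNull.

(** * Differentiability from a quadratic remainder *)

Section QuadraticRemainder.
Context {R : realType} {d : nat}.
Local Notation V := 'rV[R]_d.

Lemma lipschitz_continuous_row (W : normedModType R) (F : V -> W) (C : R) :
  (forall x y, `|F y - F x| <= C * `|y - x|) -> continuous F.
Proof.
move=> lF x; apply/(@cvgrPdist_le R W V (nbhs x) _ F (F x)) => e e0.
have C1 : 0 < `|C| + 1 by rewrite ltr_pwDr.
near=> y; rewrite distrC (le_trans (lF x y))//.
apply: (@le_trans _ _ ((`|C| + 1) * `|y - x|)).
  by rewrite ler_wpM2r// (le_trans (ler_norm _))// lerDl.
rewrite mulrC -ler_pdivlMr// distrC; near: y.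
by apply: cvgr_dist_le; [exact: cvg_id|rewrite divr_gt0].
Unshelve. all: by end_near. Qed.

(** The candidate differential, named so that it can carry a structure of linear map. *)
Definition lincomb (a : 'I_d -> R) (v : V) : R := \sum_i v ord0 i * a i.

Lemma lincomb_is_linear a : linear (lincomb a).
Proof.
move=> c u v; rewrite /lincomb scaler_sumr -big_split/=.
by apply: eq_bigr => i _; rewrite !mxE mulrDl -mulrA.
Qed.

HB.instance Definition _ a :=
  GRing.isLinear.Build R V R _ (lincomb a) (lincomb_is_linear a).

Lemma lincomb_continuous a : continuous (lincomb a).
Proof.
apply: (@lipschitz_continuous_row _ _ (\sum_i `|a i|)) => x y.
rewrite /lincomb -sumrB mulr_suml (le_trans (ler_norm_sum _ _ _))//.
apply: ler_sum => i _; rewrite -mulrBl normrM mulrC ler_wpM2l//.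
by have := coord_le_norm (y - x) i; rewrite !mxE.
Qed.

Lemma quadratic_remainder_diff (A : V -> R) (x : V) (a : 'I_d -> R) (Q : R) :
  (forall v, `|A (x + v) - A x - \sum_i v ord0 i * a i| <= Q * `|v| * `|v|) ->
  differentiable A x /\ forall i, partial A i x = a i.
Proof.
move=> quad.
have Ao (e : R) : 0 < e -> \forall v \near (0 : V),
    `|A (v + x) - (A x + lincomb a v)| <= e * `|v|.
  move=> e0; near=> v.
  rewrite opprD addrA (addrC v) (le_trans (quad v))// ler_wpM2r//.
  have Q1 : 0 < `|Q| + 1 by rewrite ltr_pwDr.
  apply: (@le_trans _ _ ((`|Q| + 1) * `|v|)).
    by rewrite ler_wpM2r// (le_trans (ler_norm _))// lerDl.
  rewrite mulrC -ler_pdivlMr// -normrN -sub0r; near: v.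
  by apply: (@cvgr_dist_le _ _ _ (nbhs (0 : V)) _ id); [exact: cvg_id|rewrite divr_gt0].
have dA : 'd A x = lincomb a :> (V -> R).
  apply: diff_unique; first exact: lincomb_continuous.
  by apply/eqaddoP => e e0; exact: Ao.
split.
  apply/diff_locallyP; rewrite dA; split; first exact: lincomb_continuous.
  by apply/eqaddoP => e e0; exact: Ao.
move=> i; rewrite /partial dA /lincomb (bigD1 i)//= big1 ?addr0; last first.
  by move=> j ji; rewrite mxE (negbTE ji) andbF mul0r.
by rewrite mxE !eqxx mul1r.
Unshelve. all: by end_near. Qed.

End QuadraticRemainder.

(** * Differentiating an abstract functional of a translated kernel *)

Section TranslatedKernel.
Context {R : realType} {d : nat}.
Local Notation V := 'rV[R]_d.

Definition cont_bounded (F : V -> R) :=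
  continuous F /\ exists B : R, forall y, `|F y| <= B.

Definition lipschitz_bounded (F : V -> R) (B : R) :=
  (forall y, `|F y| <= B) /\ (forall x y, `|F y - F x| <= B * `|y - x|).

Lemma lipschitz_bounded_cont F B x : lipschitz_bounded F B ->
  cont_bounded (fun y => F (y - x)).
Proof.
move=> [bF lF]; split; last by exists B.
apply: (@lipschitz_continuous_row _ _ _ _ B) => y z.
by have := lF (y - x) (z - x); rewrite opprB addrA subrK.
Qed.

Variables (Lam : (V -> R) -> R) (C : R).
Hypothesis Lam_lin : forall (c : R) F G, cont_bounded F -> cont_bounded G ->
  Lam (fun y => F y + c * G y) = Lam F + c * Lam G.
Hypothesis Lam_le : forall F (B : R), cont_bounded F -> 0 <= B ->
  (forall y, `|F y| <= B) -> `|Lam F| <= C * B.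

Lemma cont_bounded_lin (c : R) F G : cont_bounded F -> cont_bounded G ->
  cont_bounded (fun y => F y + c * G y).
Proof.
move=> [cF [B bF]] [cG [B' bG]]; split.
  move=> x; apply: (@cvgD _ _ _ (nbhs x) _ F (fun y => c * G y)); first exact: cF.
  by apply: (@cvgM _ _ (nbhs x) _ (fun=> c) G); [exact: cvg_cst|exact: cG].
exists (B + `|c| * B') => y; rewrite (le_trans (ler_normD _ _))// lerD// normrM.
by rewrite ler_wpM2l.
Qed.

Lemma cont_bounded0 : cont_bounded (fun=> 0).
Proof. by split; [exact: cst_continuous|exists 0 => y; rewrite normr0]. Qed.

Lemma cont_bounded_sum (s : seq 'I_d) (c : 'I_d -> R) (F : 'I_d -> V -> R) :
  (forall i, cont_bounded (F i)) -> cont_bounded (fun y => \sum_(i <- s) c i * F i y).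
Proof.
move=> bF; elim: s => [|i s ih].
  under eq_fun do rewrite big_nil; exact: cont_bounded0.
by under eq_fun do rewrite big_cons addrC; exact: cont_bounded_lin.
Qed.

Lemma Lam_sum (s : seq 'I_d) (c : 'I_d -> R) (F : 'I_d -> V -> R) :
  (forall i, cont_bounded (F i)) ->
  Lam (fun y => \sum_(i <- s) c i * F i y) = \sum_(i <- s) c i * Lam (F i).
Proof.
move=> bF; elim: s => [|i s ih].
  (* The empty sum asks for [Lam 0 = 0], read off [Lam_le] with [B = 0]. *)
  under eq_fun do rewrite big_nil; rewrite big_nil; apply/eqP; rewrite -normr_le0.
  rewrite -[leRHS](mulr0 C); apply: Lam_le => //; first exact: cont_bounded0.
  by move=> y; rewrite normr0.
under eq_fun do rewrite big_cons addrC.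
by rewrite Lam_lin//; [rewrite big_cons addrC ih|exact: cont_bounded_sum].
Qed.

Lemma LamB F G : cont_bounded F -> cont_bounded G ->
  Lam (fun y => F y - G y) = Lam F - Lam G.
Proof.
by move=> bF bG; under eq_fun do rewrite -mulN1r; rewrite Lam_lin// mulN1r.
Qed.

Lemma Lam_translate_lipschitz F B x x' : lipschitz_bounded F B ->
  `|Lam (fun y => F (y - x')) - Lam (fun y => F (y - x))| <= C * B * `|x' - x|.
Proof.
move=> lF; have [bF lipF] := lF.
have B0 : 0 <= B by exact: le_trans (normr_ge0 _) (bF 0).
rewrite -LamB; [|exact: lipschitz_bounded_cont..].
rewrite -mulrA; apply: Lam_le; [|by rewrite mulr_ge0|].
  have := cont_bounded_lin (-1) (lipschitz_bounded_cont x' lF) (lipschitz_bounded_cont x lF).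
  by under eq_fun do rewrite mulN1r.
move=> y; rewrite (le_trans (lipF _ _))//.
have -> : y - x' - (y - x) = - (x' - x) by apply/rowP => j; rewrite !mxE; ring.
by rewrite normrN.
Qed.

(** The Taylor remainder of [k] at [y - x] is quadratic uniformly in [y], and [Lam] is bounded for
    the sup norm, so the remainder stays quadratic after applying [Lam]. The minus sign is that of
    [x] in [y - x]. In the instances the weight [g] is part of [Lam]. *)
Lemma Lam_translate_diff (k : V -> R) (B : R) :
  (forall x, differentiable k x) -> lipschitz_bounded k B ->
  (forall i, lipschitz_bounded (partial k i) B) ->
  forall x, differentiable (fun x => Lam (fun y => k (y - x))) x /\
    forall i, partial (fun x => Lam (fun y => k (y - x))) i x
      = - Lam (fun y => partial k i (y - x)).
Proof.
move=> dk lk lpk x; apply: (@quadratic_remainder_diff _ _ _ _ _ (C * (d%:R * B))) => v.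
have B0 : 0 <= B by have [bk _] := lk; exact: le_trans (normr_ge0 _) (bk 0).
have cpk i := lipschitz_bounded_cont x (lpk i).
have -> : \sum_i v ord0 i * - Lam (fun y => partial k i (y - x)) =
    - Lam (fun y => \sum_i v ord0 i * partial k i (y - x)).
  by rewrite Lam_sum// -sumrN; apply: eq_bigr => i _; rewrite mulrN.
have cs := cont_bounded_sum (index_enum 'I_d) (fun i => v ord0 i) cpk.
have cB := cont_bounded_lin (-1) (lipschitz_bounded_cont (x + v) lk) (lipschitz_bounded_cont x lk).
rewrite opprK -LamB; [|exact: lipschitz_bounded_cont lk..].
have -> : Lam (fun y => k (y - (x + v)) - k (y - x)) +
    Lam (fun y => \sum_i v ord0 i * partial k i (y - x)) =
    Lam (fun y => (k (y - (x + v)) + -1 * k (y - x)) +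
      1 * \sum_i v ord0 i * partial k i (y - x)).
  by rewrite Lam_lin// mul1r; congr (_ + _); under eq_fun do rewrite -mulN1r.
rewrite -!mulrA; apply: Lam_le; [exact: cont_bounded_lin|by rewrite !mulr_ge0|].
move=> y; rewrite mul1r mulN1r.
have := @taylor_lipschitz _ _ k B dk (fun i => (lpk i).2) (y - x) (- v).
rewrite normrN -!mulrA opprD addrA; congr (`|_| <= _).
by congr (_ + _); rewrite -sumrN; apply: eq_bigr => i _; rewrite mxE mulNr opprK.
Qed.

End TranslatedKernel.

(** * Bounds on the rescaled kernel and its partial derivatives *)

Section KernelRegularity.
Context {R : realType} {d : nat}.
Local Notation V := 'rV[R]_d.

Lemma partial_near0 (F : V -> R) i x : differentiable F x ->
  (\forall y \near x, F y = 0) -> partial F i x = 0.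
Proof.
move=> dF F0; rewrite /partial -deriveE// (@near_eq_derive _ _ _ F (cst 0)) ?derive_cst//.
Qed.

Variables (k : V -> R) (h : R).
Hypothesis C2k : C2 k.
Hypothesis suppk : closure [set x | k x != 0] = @Ball1 R d.
Hypothesis h0 : 0 < h.

Let closedB : closed (@Ball1 R d).
Proof. by rewrite -suppk; exact: closed_closure. Qed.

Let compactB : compact (@Ball1 R d).
Proof.
apply: bounded_closed_compact => //; exists 1; split=> // M M1 x /= xB.
by rewrite (le_trans (norm_le_enorm _))// (le_trans xB)// ltW.
Qed.

Let near_out (F : V -> R) x : (forall y, ~ Ball1 y -> F y = 0) -> ~ Ball1 x ->
  \forall y \near x, F y = 0.
Proof.
move=> F0 xB; have : open_nbhs x (~` @Ball1 R d) by split=> //; exact: closed_openC.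
by move=> /open_nbhs_nbhs; apply: filterS => y; exact: F0.
Qed.

Let k_out y : ~ Ball1 y -> k y = 0.
Proof.
move=> yB; apply/eqP; apply: contrapT => ky; apply: yB; rewrite -suppk.
by apply: subset_closure => /=; apply/negP.
Qed.

Let dk x : differentiable k x. Proof. by have [] := C2k. Qed.
Let dpk i x : differentiable (partial k i) x. Proof. by have [_ []] := C2k. Qed.

Let pk_out i y : ~ Ball1 y -> partial k i y = 0.
Proof. by move=> yB; apply: partial_near0 => //; exact: near_out. Qed.

Let ppk_out i j y : ~ Ball1 y -> partial (partial k i) j y = 0.
Proof. by move=> yB; apply: partial_near0 => //; apply: near_out => // z; exact: pk_out. Qed.

Let bounded_of_out (F : V -> R) : continuous F -> (forall y, ~ Ball1 y -> F y = 0) ->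
  exists2 B : R, 0 <= B & forall y, `|F y| <= B.
Proof.
move=> cF F0; have /ex_strict_bound_gt0[B B0 /= hB] : bounded_set (F @` @Ball1 R d).
  apply/compact_bounded/continuous_compact => //.
  by apply: continuous_subspaceT => x; exact: cF.
exists B => [|y]; first exact: ltW.
have [yB|yB] := pselect (Ball1 y); first by rewrite ltW// hB//; exists y.
by rewrite F0// normr0 ltW.
Qed.

Lemma partial_kh i u : partial (kh k h) i u = h^-1 * partial k i (h^-1 *: u).
Proof.
rewrite /partial /kh.
have -> : (fun u => k (h^-1 *: u)) = k \o ( *:%R h^-1) by [].
have [dsc scE] : is_diff u ( *:%R h^-1 : V -> V) ( *:%R h^-1) by exact: is_diff_scaler.
transitivity ('d k (h^-1 *: u) (h^-1 *: evec R i)).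
  have dE := congr1 (fun l : V -> R => l (evec R i)) (diff_comp dsc (dk (h^-1 *: u))).
  apply: (etrans dE).
  exact: (congr1 (fun l : V -> V => 'd k (h^-1 *: u) (l (evec R i))) scE).
exact: linearZ_LR.
Qed.

Lemma differentiable_kh u : differentiable (kh k h) u.
Proof.
rewrite /kh; have -> : (fun u => k (h^-1 *: u)) = k \o ( *:%R h^-1) by [].
have [dsc _] : is_diff u ( *:%R h^-1 : V -> V) ( *:%R h^-1) by exact: is_diff_scaler.
exact: (differentiable_comp dsc (dk _)).
Qed.

(** [k] and its partials up to order two are continuous and vanish off the compact unit ball, hence
    are bounded; bounds on second partials make the first partials Lipschitz. *)
Lemma kh_lipschitz_bounded : exists B : R, lipschitz_bounded (kh k h) B /\
  forall i, lipschitz_bounded (partial (kh k h) i) B.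
Proof.
have [B0 B00 hB0] := bounded_of_out (fun x => differentiable_continuous (dk x)) k_out.
have /choice[B1 hB1] : forall i, exists B, 0 <= B /\ forall y, `|partial k i y| <= B.
  move=> i; have [B] := bounded_of_out
    (fun x => differentiable_continuous (dpk i x)) (@pk_out i).
  by exists B.
have /choice[B2 hB2] : forall ij : 'I_d * 'I_d, exists B, 0 <= B /\
    forall y, `|partial (partial k ij.1) ij.2 y| <= B.
  move=> [i j]; have [|B] := bounded_of_out _ (@ppk_out i j); last by exists B.
  by have [_ [_]] := C2k; exact.
pose S1 := \sum_i B1 i; pose S2 := \sum_ij B2 ij.
have hS1 i y : `|partial k i y| <= S1.
  rewrite /S1 (bigD1 i)//= (le_trans ((hB1 i).2 y))// lerDl.
  by apply: sumr_ge0 => j _; exact: (hB1 j).1.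
have hS2 i j y : `|partial (partial k i) j y| <= S2.
  rewrite /S2 (bigD1 (i, j))//= (le_trans ((hB2 (i, j)).2 y))// lerDl.
  by apply: sumr_ge0 => ij _; exact: (hB2 ij).1.
have S10 : 0 <= S1 by apply: sumr_ge0 => i _; exact: (hB1 i).1.
have S20 : 0 <= S2 by apply: sumr_ge0 => i _; exact: (hB2 i).1.
have hi : 0 <= h^-1 by rewrite invr_ge0 ltW.
have l1 := globally_lipschitz dk (fun z i => hS1 i z).
have l2 i := globally_lipschitz (dpk i) (fun z j => hS2 i j z).
have sc x y : `|h^-1 *: y - h^-1 *: x| = h^-1 * `|y - x|.
  by rewrite -scalerBr normrZ ger0_norm.
(* One summand for each of the four bounds: size and Lipschitz constant of [kh k h], then of its
   partials. *)
exists (B0 + d%:R * S1 * h^-1 + h^-1 * S1 + h^-1 * (d%:R * S2 * h^-1)).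
have p1 : 0 <= d%:R * S1 * h^-1 by rewrite !mulr_ge0.
have p2 : 0 <= h^-1 * S1 by rewrite mulr_ge0.
have p3 : 0 <= h^-1 * (d%:R * S2 * h^-1) by rewrite !mulr_ge0.
split=> [|i]; split=> [y|x y].
- by rewrite (le_trans (hB0 _))// -!addrA lerDl !addr_ge0.
- rewrite (le_trans (l1 _ _))// sc mulrA ler_wpM2r//.
  by lra.
- by rewrite partial_kh normrM ger0_norm// (le_trans (ler_wpM2l hi (hS1 i _)))//; lra.
- rewrite !partial_kh -mulrBr normrM ger0_norm//.
  rewrite (le_trans (ler_wpM2l hi (l2 i _ _)))// sc !mulrA ler_wpM2r//.
  by rewrite -!mulrA; rewrite -!mulrA in p1 p2 p3; lra.
Qed.

End KernelRegularity.

(** * Measurability of functions continuous at the points of a Borel set *)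

Section RestrictedExpectation.
Context {R : realType} {d : nat} {dT : measure_display} {T : measurableType dT}.
Local Notation V := 'rV[R]_d.
Variables (P : probability T R) (X0 : T -> V).
Hypothesis mX0 : forall A, borel_rV A -> measurable (X0 @^-1` A).

Lemma measurable_restricted (L : set V) (H : V -> R) : borel_rV L ->
  (forall x, L x -> {for x, continuous H}) ->
  measurable_fun setT (fun w => \1_L (X0 w) * H (X0 w) : R).
Proof.
move=> bL cH; apply: (measurability _ (RGenOInfty.measurableE R)) => //.
move=> _ [_ [r ->] <-]; rewrite setTI.
(* On L the set {H > r} agrees with its interior, which is open. *)
have -> : (fun w => \1_L (X0 w) * H (X0 w)) @^-1` `]r, +oo[ =
    X0 @^-1` ((L `&` (interior [set y | r < H y])) `|` (~` L `&` [set _ | r < 0])).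
  apply/seteqP; split=> w /=; rewrite in_itv/= andbT indicE.
    case: (boolP (X0 w \in L)) => [/set_mem Lw|/negP Lw].
      rewrite mul1r => rH; left; split=> //.
      by have /cvgr_gt : H y @[y --> X0 w] --> H (X0 w) by [exact: cH]; apply.
    rewrite mul0r => r0; right; split=> // Lw'; apply: Lw; exact/mem_set.
  case=> [[Lw /interior_subset /= rH]|[Lw r0]]; first by rewrite mem_set// mul1r.
  by rewrite memNset// mul0r.
apply: mX0; apply: borelU; apply: borelI => //.
- by apply: borel_open; exact: open_interior.
- exact: borelC.
- have [r0|r0] := pselect (r < 0).
    by rewrite (_ : [set _ | _] = setT); [exact: borelT|apply/seteqP; split].
  rewrite (_ : [set _ | _] = set0); first by apply: borel_open; exact: open0.
  by apply/seteqP; split.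
Qed.

Lemma bounded_rv_restricted (L : set V) (H : V -> R) (B : R) : borel_rV L ->
  (forall x, L x -> {for x, continuous H}) -> (forall x, L x -> `|H x| <= B) ->
  bounded_rv (fun w => \1_L (X0 w) * H (X0 w) : R).
Proof.
move=> bL cH bH; split; first exact: measurable_restricted.
exists `|B| => w; rewrite indicE; case: (boolP (X0 w \in L)) => [/set_mem Lw|_].
  by rewrite mul1r (le_trans (bH _ Lw))// ler_norm.
by rewrite mul0r normr0.
Qed.

End RestrictedExpectation.

(** * Frequencies of Borel sets along the sample *)

Section EmpiricalFrequency.
Context {R : realType} {d : nat} {dT : measure_display} {T : measurableType dT}.
Local Notation V := 'rV[R]_d.
Variables (P : probability T R) (X : nat -> T -> V).
Hypothesis mX : forall i A, borel_rV A -> measurable (X i @^-1` A).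
Hypothesis idX : forall i A, borel_rV A -> P (X i @^-1` A) = P (X 0%N @^-1` A).
Hypothesis indX : forall (n : nat) (A : nat -> set V), (forall i, borel_rV (A i)) ->
  P (\bigcap_(i < n) (X i @^-1` A i)) = (\prod_(i < n) P (X i @^-1` A i))%E.

(** Joint independence of the first [j.+1] variables, with the full space at every index other than
    [i] and [j]. *)
Lemma pair_indep i j A : (i < j)%N -> borel_rV A ->
  P (X i @^-1` A `&` X j @^-1` A) = (P (X i @^-1` A) * P (X j @^-1` A))%E.
Proof.
move=> ij bA; pose S l := if (l == i) || (l == j) then A else setT.
have bS l : borel_rV (S l) by rewrite /S; case: ifP => // _; exact: borelT.
have Si : S i = A by rewrite /S eqxx.
have Sj : S j = A by rewrite /S eqxx orbT.
have := @indX j.+1 S bS.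
have -> : \bigcap_(l < j.+1) (X l @^-1` S l) = X i @^-1` A `&` X j @^-1` A.
  apply/seteqP; split=> w /= => [Sw|[Ai Aj] l _].
    split; first by have := Sw i (leqW ij); rewrite Si.
    by have := Sw j (ltnSn j); rewrite Sj.
  by rewrite /S /preimage/=; case: eqVneq => [->//|_]; case: eqVneq => [->|].
move=> ->; have ltij := leqW ij.
rewrite (bigD1 (Ordinal ltij))//= (bigD1 (Ordinal (ltnSn j)))/=; last first.
  by rewrite -val_eqE /= gtn_eqF.
rewrite Si Sj big1 ?mule1// => l /andP[li lj].
rewrite /S -(inj_eq val_inj)/= in li lj *; rewrite (negbTE li).
move: lj; rewrite -(inj_eq val_inj)/= => /negbTE ->/=.
by rewrite preimage_setT; exact: probability_setT.
Qed.

Lemma frequency_lln A : borel_rV A -> {ae P, forall w, forall e : R, 0 < e ->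
  \forall n \near \oo,
   `|\sum_(i < n) \1_A (X i w) - n%:R * fine (P (X 0%N @^-1` A))| <= e * n%:R}.
Proof.
move=> bA; set p := fine _.
have PA i : P (X i @^-1` A) = p%:E.
  by rewrite idX// fineK// fin_num_measure//; exact: mX.
apply: (@pairwise_lln _ _ _ P (fun i => X i @^-1` A) p) => [i|//|i j].
  exact: mX.
rewrite neq_ltn => /orP[ij|ji]; first by rewrite pair_indep// !PA.
by rewrite setIC pair_indep// !PA.
Qed.

End EmpiricalFrequency.

(** * Step functions on a finite family of balls *)

Section StepFunction.
Context {R : realType} {d : nat}.
Local Notation V := 'rV[R]_d.
Variables (s : seq V) (r : R).

(** The balls made disjoint: a point goes to the first ball that contains it. *)
Definition piece (m : nat) : set V :=
  [set y | ball (nth 0 s m) r y /\ forall l, (l < m)%N -> ~ ball (nth 0 s l) r y].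

Definition step_fun (v : V -> R) (y : V) : R :=
  \sum_(m < size s) v (nth 0 s m) * \1_(piece m) y.

Lemma borel_piece m : 0 < r -> borel_rV (piece m).
Proof.
move=> r0; have bb l : borel_rV (ball (nth 0 s l) r : set V).
  by apply: borel_open; exact: ball_open.
suff bn : borel_rV [set y : V | forall l, (l < m)%N -> ~ ball (nth 0 s l) r y].
  exact: borelI (bb m) bn.
elim: (m) => [|q ih].
  by rewrite (_ : [set _ | _] = setT); [exact: borelT|apply/seteqP; split].
rewrite (_ : [set _ | _] = [set y : V | forall l, (l < q)%N -> ~ ball (nth 0 s l) r y]
    `&` ~` ball (nth 0 s q) r); first exact: borelI ih (borelC (bb q)).
apply/seteqP; split=> y /= => [yl|[yl yq] l].
  by split=> [l lq|]; apply: yl => //; exact: ltnW.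
by rewrite ltnS leq_eqVlt => /predU1P[->//|/yl].
Qed.

(** Which centre gives the value is left open: any centre within [r] of [y] is good enough for the
    estimates. *)
Lemma step_fun_cases v y :
  (exists2 c, c \in s & ball c r y /\ step_fun v y = v c) \/
  ((forall c, c \in s -> ~ ball c r y) /\ step_fun v y = 0).
Proof.
have [[m0 [ms ym]]|none] := pselect (exists m, (m < size s)%N /\ ball (nth 0 s m) r y).
  left; pose Q m := (m < size s)%N && `[< ball (nth 0 s m) r y >].
  have exQ : exists m, Q m by exists m0; rewrite /Q ms; apply/asboolP.
  case: (ex_minnP exQ) => m /andP[{}ms /asboolP {}ym] mmin.
  exists (nth 0 s m); first exact: mem_nth.
  split=> //; rewrite /step_fun (bigD1 (Ordinal ms))//= big1 ?addr0.
    rewrite indicE mem_set ?mulr1//; split=> // l lm yl.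
    by have := mmin l; rewrite /Q (ltn_trans lm ms) asboolT// => /(_ isT); rewrite leqNgt lm.
  move=> l; rewrite -val_eqE/= => lm; rewrite indicE memNset ?mulr0// => -[yl yl'].
  have := mmin l; rewrite /Q ltn_ord asboolT// => /(_ isT).
  by rewrite leq_eqVlt eq_sym (negbTE lm)/= => /yl'.
right; have out c : c \in s -> ~ ball c r y.
  move=> cs yc; apply: none; exists (index c s); rewrite index_mem; split=> //.
  by rewrite nth_index.
split=> //; rewrite /step_fun big1// => m _; rewrite indicE memNset ?mulr0// => -[ym _].
by apply: out ym; exact: mem_nth.
Qed.

End StepFunction.

(** Real-valued counterpart of the unit ball of W: both the real and the imaginary part of an
    element of that ball satisfy it. *)
Definition W1ball {R : realType} {d : nat} (L : set 'rV[R]_d) (g : 'rV[R]_d -> R) :=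
  forall x, L x -> [/\ `|g x| <= 1, differentiable g x & forall i, `|partial g i x| <= 1].

(* Unnormalised versions of the empirical and conditional integrals: the factors
   n / j(n) and 1 / mu (L(t)) cancel in the quotients defining both operators. *)
Definition emp_int {R : realType} {d : nat} {T : Type} (X : nat -> T -> 'rV[R]_d)
    (fn : 'rV[R]_d -> R) (t : R) (n : nat) (w : T) (F : 'rV[R]_d -> R) : R :=
  n%:R^-1 * \sum_(j < n | t <= fn (X j w)) F (X j w).

Definition lev_int {R : realType} {d : nat} {dT : measure_display}
    {T : measurableType dT} (P : probability T R) (X0 : T -> 'rV[R]_d)
    (f : 'rV[R]_d -> R) (t : R) (F : 'rV[R]_d -> R) : R :=
  Ex P (fun w => \1_(lev f t) (X0 w) * F (X0 w)).

(** * The law of large numbers, uniform in [g] and [x] *)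

Section UniformLLN.
Context {R : realType} {d : nat} {dT : measure_display} {T : measurableType dT}.
Local Notation V := 'rV[R]_d.
Variables (P : probability T R) (X : nat -> T -> V) (f : V -> R) (t K : R).
Variables (eps : nat -> R) (phi phiinv : nat -> V -> V).
Hypothesis mX : forall i A, borel_rV A -> measurable (X i @^-1` A).
Hypothesis idX : forall i A, borel_rV A -> P (X i @^-1` A) = P (X 0%N @^-1` A).
Hypothesis indX : forall (n : nat) (A : nat -> set V), (forall i, borel_rV (A i)) ->
  P (\bigcap_(i < n) (X i @^-1` A i)) = (\prod_(i < n) P (X i @^-1` A i))%E.
Hypothesis cf : continuous f.
Hypothesis K0 : 0 <= K.
Hypothesis lipf : forall x y, `|f y - f x| <= K * `|y - x|.
Hypothesis compactL : compact (lev f t).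
Hypothesis small : forall eta : R, 0 < eta -> exists2 e : R, 0 < e &
    fine (P (X 0%N @^-1` lev_ab f (t - e) (t + e))) <= eta.
Hypothesis eps0 : eps @ \oo --> (0 : R).
Hypothesis phiK : forall n, cancel (phi n) (phiinv n).
Hypothesis phiL : forall n, phi n @` lev f t = lev f (t - eps n).
Hypothesis phi_id : forall e : R, 0 < e -> \forall n \near \oo,
  forall x, lev f t x -> `|phi n x - x| <= e.

Let borelL : borel_rV (lev f t).
Proof. by apply: borel_closed; exact: closed_superlevel. Qed.

Lemma W1ball_lip g c (r : R) z : W1ball (lev f t) g ->
  (forall y, ball c r y -> lev f t y) -> 0 < r -> ball c r z ->
  `|g z - g c| <= d%:R * r.
Proof.
move=> Wg cL r0 cz.
have dg y : ball c r y -> differentiable g y by move=> /cL/Wg[].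
have bg y : ball c r y -> forall i, `|partial g i y| <= 1 by move=> /cL/Wg[].
rewrite (le_trans (ball_lipschitz (ballxx c r0) cz dg bg))// mulr1 ler_wpM2l//.
by move: cz; rewrite -ball_normE/= distrC => /ltW.
Qed.

Section Pointwise.
Variables (Bk e r : R) (s : seq V) (ka g : V -> R) (x : V).
Hypothesis lk : lipschitz_bounded ka Bk.
Hypothesis Wg : W1ball (lev f t) g.
Hypothesis r0 : 0 < r.
Hypothesis sL : forall c, c \in s -> forall y, ball c (2 * r) y -> lev f t y.
Hypothesis scover : forall y, t + e < f y -> exists2 c, c \in s & ball c r y.

Let Bk0 : 0 <= Bk.
Proof. by have [h _] := lk; exact: le_trans (normr_ge0 _) (h 0). Qed.

Let v c := ka (c - x) * g c.

Let ball_2r (c y : V) : ball c r y -> ball c (2 * r) y.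
Proof. by apply: le_ball; rewrite ler_peMl ?ltW// ltr1n. Qed.

(** One estimate for both integrals: [b] tells whether [y] is selected, [px] is where the kernel is
    centred, [py] where [g] is read. The empirical case takes [phi n x] and [phiinv n y], the limit
    case [x] and [y]. Below the band both terms vanish, above it [y] lies in a ball of the cover,
    and inside it only the crude bound [2 * Bk] is used. *)
Lemma step_fun_approx (b : bool) (y px py : V) : 0 < e ->
  (b -> lev f t py /\ `|py - y| < r) -> `|px - x| <= r ->
  (t + e < f y -> b) -> (f y < t - e -> ~~ b) ->
  `|(if b then ka (y - px) * g py else 0) - step_fun s r v y|
    <= 2 * (d%:R + 1) * Bk * r + 2 * Bk * \1_(lev_ab f (t - e) (t + e)) y.
Proof.
move=> e0 bL pxr bin bout; have [bk lipk] := lk.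
have osc0 : 0 <= 2 * (d%:R + 1) * Bk * r by rewrite !mulr_ge0// ?addr_ge0// ltW.
have [ylo|ylo] := ltP (f y) (t - e).
  rewrite (negbTE (bout ylo)).
  have [[c cs [yc _]]|[_ ->]] := step_fun_cases s r v y.
    have := sL cs (ball_2r yc); rewrite /lev/= => ty.
    by exfalso; move: ylo; rewrite ltNge (le_trans _ ty)// gerBl ltW.
  by rewrite subrr normr0 addr_ge0// !mulr_ge0.
have [yhi|yhi] := ltP (t + e) (f y).
  have bT := bin yhi; rewrite bT; have [Lpy ppy] := bL bT.
  have [[c cs [yc ->]]|[out _]] := step_fun_cases s r v y; last first.
    by have [c /out] := scover yhi.
  apply: (@le_trans _ _ (2 * (d%:R + 1) * Bk * r)); last by rewrite lerDl !mulr_ge0.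
  (* [y] is within [r] of the centre and [py] within [r] of [y]; hence the doubled balls in [sL].
     The kernel then contributes [2 * Bk * r] to the error and [g] contributes [2 * d * Bk * r]. *)
  have cpy : ball c (2 * r) py.
    move: yc; rewrite -!ball_normE/= => yc.
    have -> : c - py = (c - y) + (y - py) by rewrite addrA subrK.
    by rewrite (le_lt_trans (ler_normD _ _))// mulr_natl mulr2n ltrD// distrC.
  have rr0 : 0 < 2 * r by rewrite mulr_gt0.
  have gl := W1ball_lip Wg (sL cs) rr0 cpy.
  have [gpy _ _] := Wg Lpy.
  have kl : `|ka (y - px) - ka (c - x)| <= Bk * (2 * r).
    rewrite (le_trans (lipk _ _))// ler_wpM2l//.
    have -> : y - px - (c - x) = (y - c) - (px - x).
      by apply/rowP => i; rewrite !mxE; ring.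
    rewrite (le_trans (ler_normB _ _))// mulr_natl mulr2n lerD//.
    by move: yc; rewrite -ball_normE/= distrC => /ltW.
  have -> : ka (y - px) * g py - v c =
      (ka (y - px) - ka (c - x)) * g py + ka (c - x) * (g py - g c).
    by rewrite /v; ring.
  rewrite (le_trans (ler_normD _ _))// !normrM.
  have h1 : `|ka (y - px) - ka (c - x)| * `|g py| <= Bk * (2 * r) * 1.
    by apply: ler_pM.
  have h2 : `|ka (c - x)| * `|g py - g c| <= Bk * (d%:R * (2 * r)) by apply: ler_pM.
  by rewrite (le_trans (lerD h1 h2))// le_eqVlt; apply/orP; left; apply/eqP; ring.
have yband : lev_ab f (t - e) (t + e) y by rewrite /lev_ab/= ylo yhi.
rewrite indicE mem_set// mulr1.
apply: (@le_trans _ _ (2 * Bk)); last by rewrite lerDr.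
rewrite (le_trans (ler_normB _ _))// mulr_natl mulr2n lerD//.
  case: ifP => bT; last by rewrite normr0.
  have [Lpy _] := bL bT; have [gpy _ _] := Wg Lpy.
  by rewrite normrM -[leRHS]mulr1 ler_pM.
have [[c cs [yc ->]]|[_ ->]] := step_fun_cases s r v y; last by rewrite normr0.
have cL := sL cs (ballxx c (_ : 0 < 2 * r)).
have [gc _ _] : [/\ `|g c| <= 1, differentiable g c & forall i, `|partial g i c| <= 1].
  by apply: Wg; apply: cL; rewrite mulr_gt0.
by rewrite normrM -[leRHS]mulr1 ler_pM.
Qed.

Lemma Ex_step_fun : Ex P (fun w => step_fun s r v (X 0%N w)) =
  \sum_(m < size s) v (nth 0 s m) * fine (P (X 0%N @^-1` piece s r m)).
Proof.
have mp m : measurable (X 0%N @^-1` piece s r m).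
  by apply: mX; exact: borel_piece.
rewrite /step_fun.
rewrite (@Ex_sum _ _ _ P _ _ (fun (m : 'I_(size s)) w => v (nth 0 s m) * \1_(piece s r m) (X 0%N w))).
  apply: eq_bigr => m _; rewrite ExZ; last exact: (bounded_rv_indic (mp m)).
  by congr (_ * _); rewrite -(Ex_indic P (mp m)).
by move=> m; apply: bounded_rvZ; exact: (bounded_rv_indic (mp m)).
Qed.

Lemma bounded_rv_step_fun : bounded_rv (fun w => step_fun s r v (X 0%N w)).
Proof.
have mp m : measurable (X 0%N @^-1` piece s r m).
  by apply: mX; exact: borel_piece.
apply: (@bounded_rv_sum _ _ _ _ _ (fun (m : 'I_(size s)) w =>
  v (nth 0 s m) * \1_(piece s r m) (X 0%N w))).
by move=> m; apply: bounded_rvZ; exact: (bounded_rv_indic (mp m)).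
Qed.

Lemma bounded_rv_kernel : bounded_rv (fun w =>
  \1_(lev f t) (X 0%N w) * (ka (X 0%N w - x) * g (X 0%N w))).
Proof.
have [bk _] := lk; have [ck _] := lipschitz_bounded_cont x lk.
apply: (@bounded_rv_restricted _ _ _ _ _ _ _ (fun y => ka (y - x) * g y) (Bk * 1)) => //.
- exact: mX.
- move=> y Ly; apply: (@cvgM _ _ (nbhs y) _ (fun z => ka (z - x)) g); first exact: ck.
  by apply: differentiable_continuous; have [] := Wg Ly.
- by move=> y Ly; rewrite normrM ler_pM//; have [] := Wg Ly.
Qed.

Lemma lev_int_approx : 0 < e ->
  `|lev_int P (X 0%N) f t (fun y => ka (y - x) * g y) -
    \sum_(m < size s) v (nth 0 s m) * fine (P (X 0%N @^-1` piece s r m))|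
  <= 2 * (d%:R + 1) * Bk * r +
     2 * Bk * fine (P (X 0%N @^-1` lev_ab f (t - e) (t + e))).
Proof.
move=> e0; rewrite -Ex_step_fun /lev_int -ExB; [|exact: bounded_rv_kernel|exact: bounded_rv_step_fun].
have mB : measurable (X 0%N @^-1` lev_ab f (t - e) (t + e)).
  by apply: mX; exact: borel_lev_ab.
have bB := bounded_rv_indic (R := R) mB.
have -> : 2 * (d%:R + 1) * Bk * r + 2 * Bk *
    fine (P (X 0%N @^-1` lev_ab f (t - e) (t + e))) =
    Ex P (fun w => 2 * (d%:R + 1) * Bk * r +
      2 * Bk * \1_(X 0%N @^-1` lev_ab f (t - e) (t + e)) w).
  rewrite ExD; [|exact: bounded_rv_cst|exact: bounded_rvZ].
  by rewrite Ex_cst ExZ// Ex_indic.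
apply: Ex_norm_le.
- by apply: bounded_rvB; [exact: bounded_rv_kernel|exact: bounded_rv_step_fun].
- by apply: bounded_rvD; [exact: bounded_rv_cst|exact: bounded_rvZ].
move=> w; have := @step_fun_approx (X 0%N w \in lev f t) (X 0%N w) x (X 0%N w) e0.
rewrite !subrr normr0 => /(_ _ (ltW r0)) H.
have {}H := H (fun h => conj (set_mem h) r0).
have -> : \1_(lev f t) (X 0%N w) * (ka (X 0%N w - x) * g (X 0%N w)) =
    (if X 0%N w \in lev f t then ka (X 0%N w - x) * g (X 0%N w) else 0).
  by rewrite indicE; case: ifP; rewrite ?mul1r ?mul0r.
apply: H => [h|h]; first by apply/mem_set; rewrite /lev/= ltW// (le_lt_trans _ h)// lerDl ltW.
by apply/negP => /set_mem; rewrite /lev/= leNgt (lt_le_trans h)// gerBl ltW.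
Qed.

End Pointwise.

(** The exceptional set precedes [fn], [ka], [g] and [x] because only the frequencies of the band
    and of the pieces are random, and the cover is built without reference to these four; the rest
    is deterministic comparison. *)
Lemma uniform_lln (Bk eta : R) : 0 <= Bk -> 0 < eta ->
  {ae P, forall w, \forall n \near \oo, forall fn : V -> R,
    (forall x, `|fn x - f x| <= eps n) ->
    forall ka g x, lipschitz_bounded ka Bk -> W1ball (lev f t) g -> lev f t x ->
    `|emp_int X fn t n w (fun y => ka (y - phi n x) * g (phiinv n y)) -
      lev_int P (X 0%N) f t (fun y => ka (y - x) * g y)| <= eta}.
Proof.
move=> Bk0 eta0.
(* The final count: [q + 4 * Bk * q] between the empirical integral and its step function (band
   frequency at most [2 * q]), [Bk * q] for the frequencies of the pieces, [q + 2 * Bk * q] on the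
   limit side. *)
pose q := eta / (7 * Bk + 2).
have q0 : 0 < q by rewrite divr_gt0// ltr_wpDl// mulr_ge0.
have qE : (7 * Bk + 2) * q = eta.
  by rewrite /q mulrC divfK// gt_eqF// ltr_wpDl// mulr_ge0.
have [e e0 he] := small q0.
(* The first bound keeps the balls of radius [2 * r] around points of [lev f (t + e)] inside L(t);
   the second makes the oscillation error at most [q]. *)
pose r := Num.min (e / (2 * K + 1)) (q / (2 * (d%:R + 1) * Bk + 1)).
have D1 : 0 < 2 * K + 1 by rewrite ltr_wpDl// mulr_ge0.
have D2 : 0 < 2 * (d%:R + 1) * Bk + 1 by rewrite ltr_wpDl// !mulr_ge0// addr_ge0.
have r0 : 0 < r by rewrite lt_min; apply/andP; split; exact: divr_gt0.
have rK : K * (2 * r) <= e.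
  have : r <= e / (2 * K + 1) by rewrite ge_min lexx.
  by rewrite ler_pdivlMr//; nra.
have rq : 2 * (d%:R + 1) * Bk * r <= q.
  have : r <= q / (2 * (d%:R + 1) * Bk + 1) by rewrite ge_min lexx orbT.
  by rewrite ler_pdivlMr// mulrDr mulr1 mulrC => h; rewrite (le_trans _ h)// lerDl ltW.
have cLe : compact (lev f (t + e)).
  apply: (subclosed_compact _ compactL); first exact: closed_superlevel.
  by move=> y; rewrite /lev/=; apply: le_trans; rewrite lerDl ltW.
have [s sLe scover] := compact_ball_cover cLe (fun _ _ => r0).
have sL c : c \in s -> forall y, ball c (2 * r) y -> lev f t y.
  move=> cs y; rewrite -ball_normE/= distrC => cy; have := sLe _ cs; rewrite /lev/= => tc.
  have := lipf c y; have : K * `|y - c| <= K * (2 * r) by rewrite ler_wpM2l// ltW.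
  rewrite ler_norml => h1 /andP[h2 h3]; lra.
have {}scover y : t + e < f y -> exists2 c, c \in s & ball c r y.
  by move=> /ltW/scover.
(* A tolerance [q / N] per piece adds up to at most [q]; the added [1] covers an empty cover. *)
pose N := (size s)%:R + 1 : R.
have N0 : 0 < N by rewrite ltr_wpDl.
have fB := frequency_lln mX idX indX (borel_lev_ab (t - e) (t + e) cf).
have fp : {ae P, forall w, forall m, forall a : R, 0 < a -> \forall n \near \oo,
   `|\sum_(i < n) \1_(piece s r m) (X i w) - n%:R * fine (P (X 0%N @^-1` piece s r m))|
      <= a * n%:R}.
  by apply: ae_foralln => m; apply: frequency_lln => //; exact: borel_piece.
apply: filterS2 fB fp => w fB fp.
have fpn : \forall n \near \oo, forall m : 'I_(size s),
   `|\sum_(i < n) \1_(piece s r m) (X i w) - n%:R * fine (P (X 0%N @^-1` piece s r m))|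
      <= q / N * n%:R.
  by apply: filter_forall => m; apply: fp; rewrite divr_gt0.
have epn : \forall n \near \oo, eps n < e.
  by have /cvgr_lt := eps0; apply.
have r20 : 0 < r / 2 by rewrite divr_gt0.
have hphi := phi_id r20; have hfB := fB q q0; have n0 := nbhs_infty_gt 0.
apply: filterS2 (filterI fpn epn) (filterI (filterI hphi hfB) n0).
move=> n [{}fpn {}epn] [[{}hphi {}hfB] {}n0] fn hfn ka g x lk Wg Lx.
have nR : 0 < n%:R :> R by rewrite ltr0n.
have [bk _] := lk.
pose v c := ka (c - x) * g c.
pose pB := fine (P (X 0%N @^-1` lev_ab f (t - e) (t + e))).
have le_true := lev_int_approx x lk Wg r0 sL scover e0.
pose b j := t <= fn (X j w).
(* A selected sample point lies in [lev f (t - eps n)], the image of L(t) under [phi n], so [g] is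
   read inside L(t). *)
have bE j : b j -> lev f t (phiinv n (X j w)) /\ `|phiinv n (X j w) - X j w| < r.
  rewrite /b => tj; have : lev f (t - eps n) (X j w).
    by have := hfn (X j w); rewrite /lev/= ler_norml => /andP[h1 h2]; lra.
  rewrite -phiL => -[z Lz <-]; rewrite phiK; split=> //.
  rewrite distrC (le_lt_trans (hphi z Lz))//.
  by rewrite ltr_pdivrMr// mulr_natr mulr2n ltrDl.
have xr : `|phi n x - x| <= r.
  by rewrite (le_trans (hphi x Lx))// ler_pdivrMr// mulr_natr mulr2n lerDl ltW.
have term j : `|(if b j then ka (X j w - phi n x) * g (phiinv n (X j w)) else 0)
    - step_fun s r v (X j w)|
    <= q + 2 * Bk * \1_(lev_ab f (t - e) (t + e)) (X j w).
  have := @step_fun_approx Bk e r s ka g x lk Wg r0 sL scover (b j) (X j w) (phi n x)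
    (phiinv n (X j w)) e0 (bE j) xr.
  move=> H; apply: (le_trans (H _ _)); last by rewrite lerD2r.
    rewrite /b => h; have := hfn (X j w); rewrite ler_norml => /andP[h1 h2]; lra.
  rewrite /b -ltNge => h; have := hfn (X j w); rewrite ler_norml => /andP[h1 h2]; lra.
have emp_step : `|emp_int X fn t n w (fun y => ka (y - phi n x) * g (phiinv n y)) -
    n%:R^-1 * \sum_(j < n) step_fun s r v (X j w)| <= q + 2 * Bk * (2 * q).
  rewrite /emp_int -mulrBr normrM gtr0_norm ?invr_gt0// mulrC ler_pdivrMr//.
  rewrite big_mkcond/= -sumrB (le_trans (ler_norm_sum _ _ _))//.
  rewrite (le_trans (ler_sum _ (fun (j : 'I_n) _ => term j)))//.
  rewrite big_split/= sumr_const card_ord -mulr_sumr.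
  have -> : (q + 2 * Bk * (2 * q)) * n%:R = q *+ n + 2 * Bk * (2 * q * n%:R).
    by rewrite -[q *+ n]mulr_natr; ring.
  rewrite lerD2l ler_wpM2l ?mulr_ge0//.
  have : \sum_(i < n) \1_(lev_ab f (t - e) (t + e)) (X i w) <= n%:R * pB + q * n%:R.
    by move: hfB; rewrite ler_norml -/pB => /andP[_]; rewrite lerBlDl.
  move/le_trans; apply; rewrite mulrC -mulrDl ler_wpM2r// mulr_natl mulr2n lerD2r.
  exact: he.
have step_sum : n%:R^-1 * \sum_(j < n) step_fun s r v (X j w) =
    \sum_(m < size s) v (nth 0 s m) * (n%:R^-1 * \sum_(j < n) \1_(piece s r m) (X j w)).
  rewrite /step_fun exchange_big/= mulr_sumr; apply: eq_bigr => m _.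
  by rewrite -mulr_sumr mulrCA.
have sum_le : `|n%:R^-1 * \sum_(j < n) step_fun s r v (X j w) -
    \sum_(m < size s) v (nth 0 s m) * fine (P (X 0%N @^-1` piece s r m))| <= Bk * q.
  rewrite step_sum -sumrB (le_trans (ler_norm_sum _ _ _))//.
  apply: (@le_trans _ _ (\sum_(m < size s) Bk * (q / N))).
    apply: ler_sum => m _; rewrite -mulrBr normrM ler_pM//.
      have Lc : lev f t (nth 0 s m).
        by apply: (sL _ (mem_nth 0 (ltn_ord m))); apply: ballxx; rewrite mulr_gt0.
      by rewrite /v normrM -[leRHS]mulr1 ler_pM//; have [] := Wg _ Lc.
    have := fpn m; set S1 := \sum_(j < n) _; set pm := fine _ => h.
    have -> : n%:R^-1 * S1 - pm = n%:R^-1 * (S1 - n%:R * pm).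
      by rewrite mulrBr mulKf// gt_eqF.
    by rewrite normrM gtr0_norm ?invr_gt0// mulrC ler_pdivrMr.
  rewrite sumr_const card_ord -[leLHS]mulr_natr -mulrA ler_wpM2l//.
  rewrite mulrAC ler_pdivrMr// ler_wpM2l ?ltW//.
  by rewrite /N ltrDl.
have hpB : 2 * Bk * pB <= 2 * Bk * q by rewrite ler_wpM2l ?mulr_ge0.
have le_true' : `|lev_int P (X 0%N) f t (fun y => ka (y - x) * g y) -
    \sum_(m < size s) v (nth 0 s m) * fine (P (X 0%N @^-1` piece s r m))| <= q + 2 * Bk * q.
  by apply: (le_trans le_true); rewrite lerD.
set A2 := n%:R^-1 * \sum_(j < n) step_fun s r v (X j w) in emp_step sum_le.
set A4 := \sum_(m < size s) _ in sum_le le_true'.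
rewrite distrC in le_true'.
rewrite (le_trans (ler_distD A2 _ _))// (le_trans (lerD emp_step (ler_distD A4 _ _)))//.
rewrite (le_trans (lerD (lexx _) (lerD sum_le le_true')))// -qE.
by rewrite le_eqVlt; apply/orP; left; apply/eqP; ring.
Qed.

End UniformLLN.

(** * Quotients composed with a map, and their gradients *)

Section QuotientDerivative.
Context {R : realType} {d : nat}.
Local Notation V := 'rV[R]_d.
Implicit Types (A D : V -> R) (phi : V -> V) (S : set V).

Definition quot A D phi (x : V) : R := A (phi x) / D (phi x).

(** Chain and quotient rules, written with sums, products and inverses only, so that limits can be
    taken factor by factor. *)
Definition dquot A D phi (i : 'I_d) (x : V) : R :=
  \sum_j (partial phi i x) ord0 j *
    ((partial A j (phi x) * D (phi x) - A (phi x) * partial D j (phi x)) *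
      ((D (phi x))^-1 * (D (phi x))^-1)).

Lemma quot_diff A D phi x : differentiable A (phi x) -> differentiable D (phi x) ->
  differentiable phi x -> D (phi x) != 0 ->
  differentiable (quot A D phi) x /\ forall i, partial (quot A D phi) i x = dquot A D phi i x.
Proof.
move=> dA dD dphi D0.
have dV := differentiableV dD D0.
have dU : differentiable (A * (fun z => (D z)^-1)) (phi x) by exact: differentiableM.
have -> : quot A D phi = (A * (fun z => (D z)^-1)) \o phi by [].
split=> [|i]; first exact: differentiable_comp.
rewrite /partial diff_comp//= diff_sum_partial; apply: eq_bigr => j _.
congr (_ * _); rewrite {1}/partial diffM// diffV//.
transitivity (A (phi x) * (- (D (phi x)) ^- 2 * partial D j (phi x)) +
  (D (phi x))^-1 * partial A j (phi x)); first by [].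
move: (partial A j _) (partial D j _) (A _) (D _) D0 => p q a b b0.
by field.
Qed.

Lemma continuous_dquot A D phi i x :
  continuous A -> continuous D -> continuous phi ->
  (forall j, continuous (partial A j)) -> (forall j, continuous (partial D j)) ->
  continuous (partial phi i) -> D (phi x) != 0 ->
  {for x, continuous (dquot A D phi i)}.
Proof.
move=> cA cD cphi cpA cpD cpphi D0.
have comp (F : V -> R) : continuous F -> {for x, continuous (fun y => F (phi y))}.
  by move=> cF; apply: (@continuous_comp _ _ _ phi F); [exact: cphi|exact: cF].
have cM (F G : V -> R) : {for x, continuous F} -> {for x, continuous G} ->
    {for x, continuous (fun y => F y * G y)}.
  by move=> cF cG; apply: (@cvgM _ _ (nbhs x) _ F G).
have cB (F G : V -> R) : {for x, continuous F} -> {for x, continuous G} ->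
    {for x, continuous (fun y => F y - G y)}.
  by move=> cF cG; apply: (@cvgB _ _ _ (nbhs x) _ F G).
have cV : {for x, continuous (fun y => (D (phi y))^-1)}.
  by apply: (@cvgV _ _ (nbhs x) _ (fun y => D (phi y))) => //; exact: comp.
have cS (s : seq 'I_d) (F : 'I_d -> V -> R) : (forall j, {for x, continuous (F j)}) ->
    {for x, continuous (fun y => \sum_(j <- s) F j y)}.
  move=> cF; elim: s => [|j s ih].
    have -> : (fun y => \sum_(j <- [::]) F j y) = (fun=> 0).
      by apply/funext => y; rewrite big_nil.
    exact: cst_continuous.
  have -> : (fun y => \sum_(l <- j :: s) F l y) = (fun y => F j y + \sum_(l <- s) F l y).
    by apply/funext => y; rewrite big_cons.
  by apply: (@cvgD _ _ _ (nbhs x) _ (F j) (fun y => \sum_(j <- s) F j y)); [exact: cF|].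
apply: cS => j; apply: (cM _ _).
  apply: (@continuous_comp _ _ _ (partial phi i) (fun u : V => u ord0 j)).
    exact: cpphi.
  exact: coord_continuous.
apply: (cM _ _); last exact: (cM _ _).
by apply: (cB _ _); apply: (cM _ _); exact: (comp _).
Qed.

(** Continuity within [S] sees only values on [S], so a formula for the partials valid there
    suffices; the denominators are controlled only on L(t). *)
Lemma C1on_of_partial S (F : V -> R) (dF : 'I_d -> V -> R) :
  (forall x, S x -> differentiable F x) ->
  (forall i x, S x -> partial F i x = dF i x) ->
  (forall i x, S x -> {for x, continuous (dF i)}) -> C1on S F.
Proof.
move=> diffF pF cF; split=> // i.
apply: (@subspace_eq_continuous _ S _ (dF i)).
  by move=> x xS; apply/esym/pF/set_mem.
by apply: continuous_in_subspaceT => x xS; apply: cF; exact: set_mem.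
Qed.

Lemma partialB (F G : V -> R) i x : differentiable F x -> differentiable G x ->
  partial (F \- G) i x = partial F i x - partial G i x.
Proof.
move=> dF dG; have := congr1 (fun l : V -> R => l (evec R i)) (diffB dF dG).
exact.
Qed.

Lemma C1onB S (F G : V -> R) : C1on S F -> C1on S G -> C1on S (F \- G).
Proof.
move=> [dF cF] [dG cG]; split=> [x Sx|i].
  by apply: differentiableB; [exact: dF|exact: dG].
apply: (@subspace_eq_continuous _ S _ (partial F i \- partial G i)).
  by move=> x /set_mem Sx; apply/esym/partialB; [exact: dF|exact: dG].
by move=> x; apply: continuousB; [exact: cF|exact: cG].
Qed.

End QuotientDerivative.

(** * Calculus of uniform limits *)

Section UniformConvergence.
Context {R : realType} {I : Type}.
Variable D : set I.
Implicit Types (u : nat -> I -> R) (v : I -> R).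

(** The index type is arbitrary because the indices will be pairs of a point of L(t) and a function
    [g]. *)
Definition ucvg u v := forall e : R, 0 < e -> \forall n \near \oo,
  forall i, D i -> `|u n i - v i| <= e.

Definition ubounded v := exists2 B : R, 0 < B & forall i, D i -> `|v i| <= B.

Lemma ucvg_cst v : ucvg (fun=> v) v.
Proof. by move=> e e0; apply: nearW => n i _; rewrite subrr normr0 ltW. Qed.

Lemma ucvgD u u' v v' : ucvg u v -> ucvg u' v' ->
  ucvg (fun n i => u n i + u' n i) (fun i => v i + v' i).
Proof.
move=> uv uv' e e0; have e20 : 0 < e / 2 by rewrite divr_gt0.
apply: filterS2 (uv _ e20) (uv' _ e20) => n h h' i Di.
have -> : u n i + u' n i - (v i + v' i) = (u n i - v i) + (u' n i - v' i) by ring.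
by rewrite (le_trans (ler_normD _ _))// [leRHS](splitr e) lerD//; [exact: h|exact: h'].
Qed.

Lemma uboundedD v v' : ubounded v -> ubounded v' -> ubounded (fun i => v i + v' i).
Proof.
move=> [B B0 h] [B' B0' h']; exists (B + B'); first exact: addr_gt0.
by move=> i Di; rewrite (le_trans (ler_normD _ _))// lerD//; [exact: h|exact: h'].
Qed.

Lemma uboundedM v v' : ubounded v -> ubounded v' -> ubounded (fun i => v i * v' i).
Proof.
move=> [B B0 h] [B' B0' h']; exists (B * B'); first exact: mulr_gt0.
by move=> i Di; rewrite normrM ler_pM//; [exact: h|exact: h'].
Qed.

Lemma ucvgM u u' v v' : ubounded v -> ubounded v' -> ucvg u v -> ucvg u' v' ->
  ucvg (fun n i => u n i * u' n i) (fun i => v i * v' i).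
Proof.
move=> [B B0 bv] [B' B0' bv'] uv uv' e e0.
(* [a <= 1] absorbs the product of the two errors, bounded by [a * 1]; the cross terms give
   [B * a + a * B']. *)
pose a := Num.min 1 (e / (1 + B + B')).
have S0 : 0 < 1 + B + B' by rewrite !addr_gt0.
have a0 : 0 < a by rewrite lt_min ltr01 divr_gt0.
have aS : a * (1 + B + B') <= e by rewrite -ler_pdivlMr// ge_min lexx orbT.
have a1 : a <= 1 by rewrite ge_min lexx.
apply: filterS2 (uv _ a0) (uv' _ a0) => n h h' i Di.
have hi := h i Di; have hi' := h' i Di; have bi := bv i Di; have bi' := bv' i Di.
have -> : u n i * u' n i - v i * v' i =
  (u n i - v i) * (u' n i - v' i) + (v i * (u' n i - v' i) + (u n i - v i) * v' i) by ring.
rewrite (le_trans (ler_normD _ _))// (le_trans (lerD (lexx _) (ler_normD _ _)))//.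
rewrite !normrM (le_trans _ aS)// (_ : a * (1 + B + B') = a * 1 + (B * a + a * B')); last by ring.
by apply: lerD; [|apply: lerD]; apply: ler_pM => //; exact: le_trans hi' a1.
Qed.

Lemma ucvgN u v : ucvg u v -> ucvg (fun n i => - u n i) (fun i => - v i).
Proof.
move=> uv e e0; apply: filterS (uv e e0) => n h i Di.
by rewrite -opprD normrN; exact: h.
Qed.

Lemma uboundedN v : ubounded v -> ubounded (fun i => - v i).
Proof. by move=> [B B0 h]; exists B => // i Di; rewrite normrN; exact: h. Qed.

Lemma ucvgV u v (b : R) : 0 < b -> (forall i, D i -> b <= v i) -> ucvg u v ->
  ucvg (fun n i => (u n i)^-1) (fun i => (v i)^-1).
Proof.
(* The first bound keeps [u] above [b / 2]; the second divides by the resulting lower bound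
   [b / 2 * b] of the product of denominators. *)
move=> b0 bv uv e e0; pose a := Num.min (b / 2) (e * (b / 2 * b)).
have b20 : 0 < b / 2 by rewrite divr_gt0.
have a0 : 0 < a by rewrite lt_min b20 !mulr_gt0.
have a1 : a <= b / 2 by rewrite ge_min lexx.
have a2 : a <= e * (b / 2 * b) by rewrite ge_min lexx orbT.
apply: filterS (uv _ a0) => n h i Di; have hi := h i Di; have bi := bv i Di.
have ub : b / 2 <= u n i.
  move: (le_trans hi a1); rewrite ler_norml => /andP[h1 _]; move: bi; lra.
have u0 : 0 < u n i by exact: lt_le_trans ub.
have v0 : 0 < v i by exact: lt_le_trans bi.
have -> : (u n i)^-1 - (v i)^-1 = (v i - u n i) / (u n i * v i).
  by field; rewrite !gt_eqF.
rewrite normrM normfV distrC (@gtr0_norm _ (_ * _)) ?mulr_gt0//.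
rewrite ler_pdivrMr ?mulr_gt0// (le_trans hi)// (le_trans a2)// ler_pM2l//.
by apply: ler_pM => //; exact: ltW.
Qed.

Lemma uboundedV v (b : R) : 0 < b -> (forall i, D i -> b <= v i) ->
  ubounded (fun i => (v i)^-1).
Proof.
move=> b0 bv; exists b^-1; first by rewrite invr_gt0.
move=> i /bv bi; have v0 : 0 < v i by exact: lt_le_trans bi.
by rewrite normfV gtr0_norm// lef_pV2.
Qed.

Lemma ucvg_sum (J : Type) (s : seq J) (u : J -> nat -> I -> R) (v : J -> I -> R) :
  (forall j, ucvg (u j) (v j)) ->
  ucvg (fun n i => \sum_(j <- s) u j n i) (fun i => \sum_(j <- s) v j i).
Proof.
move=> uv; elim: s => [|j s ih].
  rewrite (_ : (fun i => _) = (fun=> 0)); last by apply/funext => i; rewrite big_nil.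
  rewrite (_ : (fun n i => _) = (fun=> fun=> 0)); first exact: ucvg_cst.
  by apply/funext => n; apply/funext => i; rewrite big_nil.
move=> e e0; have := ucvgD (uv j) ih e0; apply: filterS => n h i Di.
by rewrite !big_cons; exact: h.
Qed.

End UniformConvergence.

(** * Numerators and denominators as smooth functions of the base point *)

Section SmoothFunctionals.
Context {R : realType} {d : nat}.
Local Notation V := 'rV[R]_d.

Definition C1_bounded (A : V -> R) (B : R) :=
  [/\ forall x, differentiable A x, forall i, continuous (partial A i),
      forall x, `|A x| <= B & forall i x, `|partial A i x| <= B].

(** The functional bound has [C = 1]: empirical weights sum to at most one and [P] is a probability.
    So the kernel constant [B] is inherited unchanged, whatever [n], the sample and [g]. *)
Lemma Lam_translate_C1_bounded (Lam : (V -> R) -> R) (k : V -> R) (B : R) :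
  (forall (c : R) F G, cont_bounded F -> cont_bounded G ->
    Lam (fun y => F y + c * G y) = Lam F + c * Lam G) ->
  (forall F (B : R), cont_bounded F -> 0 <= B -> (forall y, `|F y| <= B) ->
    `|Lam F| <= 1 * B) ->
  (forall x, differentiable k x) -> lipschitz_bounded k B ->
  (forall i, lipschitz_bounded (partial k i) B) ->
  C1_bounded (fun x => Lam (fun y => k (y - x))) B /\
  forall i x, partial (fun x => Lam (fun y => k (y - x))) i x
      = - Lam (fun y => partial k i (y - x)).
Proof.
move=> lin le dk lk lpk; have H x := Lam_translate_diff lin le dk lk lpk x.
have B0 : 0 <= B by have [bk _] := lk; exact: le_trans (normr_ge0 _) (bk 0).
have pE i x : partial (fun x => Lam (fun y => k (y - x))) i x
      = - Lam (fun y => partial k i (y - x)) by have [_] := H x; exact.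
have bLam F x : lipschitz_bounded F B -> `|Lam (fun y => F (y - x))| <= B.
  move=> lF; rewrite -[leRHS]mul1r; apply: le => //; first exact: lipschitz_bounded_cont lF.
  by move=> y; have [bF _] := lF; exact: bF.
split=> //; split=> [x|i|x|i x].
- by have [] := H x.
- apply: (@lipschitz_continuous_row _ _ _ _ B) => x y; rewrite !pE opprK addrC.
  rewrite (le_trans (Lam_translate_lipschitz lin le y x (lpk i)))// mul1r.
  by rewrite distrC.
- exact: bLam.
- by rewrite pE normrN; exact: bLam.
Qed.

Section Empirical.
Context {T : Type}.
Variables (X : nat -> T -> V) (fn : V -> R) (t : R) (n : nat) (w : T) (g : V -> R).
Hypothesis bg : forall j, t <= fn (X j w) -> `|g (X j w)| <= 1.

Lemma emp_int_lin (c : R) F G :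
  emp_int X fn t n w (fun y => (F y + c * G y) * g y) =
  emp_int X fn t n w (fun y => F y * g y) + c * emp_int X fn t n w (fun y => G y * g y).
Proof.
rewrite /emp_int [c * _]mulrCA -mulrDr [c * _]mulr_sumr -big_split/=; congr (_ * _).
by apply: eq_bigr => j _; rewrite mulrDl mulrA.
Qed.

Lemma emp_int_le F (B : R) : 0 <= B -> (forall y, `|F y| <= B) ->
  `|emp_int X fn t n w (fun y => F y * g y)| <= 1 * B.
Proof.
move=> B0 bF; rewrite /emp_int normrM ger0_norm ?invr_ge0// mul1r.
apply: (@le_trans _ _ (n%:R^-1 * (n%:R * B))).
  rewrite ler_wpM2l ?invr_ge0// (le_trans (ler_norm_sum _ _ _))//.
  rewrite mulr_natl -[in leRHS](card_ord n) -sumr_const big_mkcond/=.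
  apply: ler_sum => j _; case: ifP => // tj.
  by rewrite normrM -[leRHS]mulr1 ler_pM// bg.
have [->|n0] := eqVneq (n%:R : R) 0; first by rewrite mul0r mulr0.
by rewrite mulKf.
Qed.

End Empirical.

Section Conditional.
Context {dT : measure_display} {T : measurableType dT}.
Variables (P : probability T R) (X0 : T -> V) (f : V -> R) (t : R) (g : V -> R).
Hypothesis mX0 : forall A, borel_rV A -> measurable (X0 @^-1` A).
Hypothesis cf : continuous f.
Hypothesis Wg : W1ball (lev f t) g.

Lemma bounded_rv_lev F : cont_bounded F ->
  bounded_rv (fun w => \1_(lev f t) (X0 w) * (F (X0 w) * g (X0 w))).
Proof.
move=> [cF [B bF]].
apply: (@bounded_rv_restricted _ _ _ _ _ mX0 _ (fun y => F y * g y) (B * 1)).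
- by apply: borel_closed; exact: closed_superlevel.
- move=> y Ly; apply: (@cvgM _ _ (nbhs y) _ F g); first exact: cF.
  by apply: differentiable_continuous; have [] := Wg Ly.
- by move=> y Ly; rewrite normrM ler_pM//; have [] := Wg Ly.
Qed.

Lemma lev_int_lin (c : R) F G : cont_bounded F -> cont_bounded G ->
  lev_int P X0 f t (fun y => (F y + c * G y) * g y) =
  lev_int P X0 f t (fun y => F y * g y) + c * lev_int P X0 f t (fun y => G y * g y).
Proof.
move=> cF cG; have bF := bounded_rv_lev cF; have bG := bounded_rv_lev cG.
rewrite /lev_int -ExZ// -ExD//; last exact: bounded_rvZ.
by congr (Ex P _); apply/funext => w; ring.
Qed.

Lemma lev_int_le F (B : R) : cont_bounded F -> 0 <= B -> (forall y, `|F y| <= B) ->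
  `|lev_int P X0 f t (fun y => F y * g y)| <= 1 * B.
Proof.
move=> cF B0 bF; rewrite mul1r -[leRHS](Ex_cst P); apply: Ex_norm_le.
- exact: bounded_rv_lev.
- exact: bounded_rv_cst.
move=> w; rewrite indicE; case: (boolP (X0 w \in _)) => [/set_mem Lw|_].
  by rewrite mul1r normrM -[leRHS]mulr1 ler_pM//; have [] := Wg Lw.
by rewrite mul0r normr0.
Qed.

End Conditional.

Lemma W1ball_one (L : set V) : W1ball L (fun=> 1).
Proof.
move=> x _; split; [by rewrite normr1|exact: differentiable_cst|].
by move=> i; rewrite /partial (diff_cst (V := V) (W := R) 1 x) normr0.
Qed.

End SmoothFunctionals.

(** * Both operators as quotients of unnormalised integrals *)

Section OperatorsAsQuotients.
Context {R : realType} {d : nat} {dT : measure_display} {T : measurableType dT}.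
Local Notation V := 'rV[R]_d.
Variables (P : probability T R) (X : nat -> T -> V) (f : V -> R) (t : R).
Variables (k : V -> R) (h : R).

Definition empA (fn : V -> R) (psi : V -> V) n w (g : V -> R) (z : V) : R :=
  emp_int X fn t n w (fun y => kh k h (y - z) * g (psi y)).

Definition levA (g : V -> R) (x : V) : R :=
  lev_int P (X 0%N) f t (fun y => kh k h (y - x) * g y).

Lemma sum_Jset (fn : V -> R) n w (G : V -> R) :
  \sum_(j <- Jset X fn t n w) G (X j w) = \sum_(j < n | t <= fn (X j w)) G (X j w).
Proof.
by rewrite /Jset big_filter -(big_mkord (fun j => t <= fn (X j w)) (fun j => G (X j w)))
  /index_iota subn0.
Qed.

Lemma Pnt_int_quot (fn : V -> R) (psi : V -> V) n w (g : V -> R) (z : V) :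
  Pnt_int X fn t n w (fun y => qnh X fn t n w k h z y * g (psi y)) =
  empA fn psi n w g z / empA fn psi n w (fun=> 1) z.
Proof.
rewrite /empA /Pnt_int /emp_int /qnh.
under eq_bigr do rewrite mulrAC.
rewrite -mulr_suml mulrA; set N := (size _)%:R^-1.
rewrite /Knh /Pnt_int -/N (sum_Jset _ _ _ (fun y => kh k h (y - z))).
rewrite (sum_Jset _ _ _ (fun y => kh k h (y - z) * g (psi y))).
have -> : \sum_(j < n | t <= fn (X j w)) kh k h (X j w - z) =
    \sum_(j < n | t <= fn (X j w)) kh k h (X j w - z) * 1.
  by apply: eq_bigr => j _; rewrite mulr1.
(* [N] vanishes exactly when no sample point is selected; the numerator sum is then empty and both
   sides are [0]. *)
have [N0|N0] := eqVneq N 0.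
  have J0 : \sum_(j < n | t <= fn (X j w)) kh k h (X j w - z) * g (psi (X j w)) = 0.
    rewrite -(sum_Jset _ _ _ (fun y => kh k h (y - z) * g (psi y))).
    move/eqP: N0; rewrite /N invr_eq0 pnatr_eq0 size_eq0 => /eqP ->.
    by rewrite big_nil.
  by rewrite J0 !mulr0 !mul0r.
rewrite -mulf_div divff// mul1r.
have [->|n0] := eqVneq n 0%N; first by rewrite !big_ord0 !mulr0 !mul0r.
by rewrite -mulf_div divff ?mul1r// invr_eq0 pnatr_eq0.
Qed.

(** The normalisation [1 / p] of the outer integral cancels the factor [p] from the inverse of
    [Kh]. *)
Lemma mut_int_quot (g : V -> R) (x : V) (B : R) :
  (forall i A, borel_rV A -> measurable (X i @^-1` A)) -> continuous f ->
  lipschitz_bounded (kh k h) B -> W1ball (lev f t) g ->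
  fine (P (X 0%N @^-1` lev f t)) != 0 ->
  mut_int P (X 0%N) f t (fun y => qh P (X 0%N) f t k h x y * g y) =
  levA g x / levA (fun=> 1) x.
Proof.
move=> mX cf lk Wg p0; rewrite /mut_int; set p := fine (P _) in p0 *.
have KE : Kh P (X 0%N) f t k h x = levA (fun=> 1) x / p.
  rewrite /Kh /mut_int /levA /lev_int /Ex -/p; congr (fine _ / _).
  by apply: eq_integral => w _; rewrite mulr1.
rewrite -/(Ex P (fun w => \1_(lev f t) (X 0%N w) * (qh P (X 0%N) f t k h x (X 0%N w) * g (X 0%N w)))).
have -> : (fun w => \1_(lev f t) (X 0%N w) * (qh P (X 0%N) f t k h x (X 0%N w) * g (X 0%N w))) =
    (fun w => (Kh P (X 0%N) f t k h x)^-1 *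
      (\1_(lev f t) (X 0%N w) * (kh k h (X 0%N w - x) * g (X 0%N w)))).
  by apply/funext => w; rewrite /qh; ring.
rewrite ExZ; last exact: bounded_rv_kernel lk Wg.
rewrite KE invf_div -/(lev_int P (X 0%N) f t (fun y => kh k h (y - x) * g y)) -/(levA g x).
have pp : p * p^-1 = 1 by rewrite divff.
move: pp (levA g x) ((levA (fun=> 1) x)^-1) => + a y.
by move: (p^-1) => z pz; have -> : p * y * a * z = a * y * (p * z) by [ring]; rewrite pz mulr1.
Qed.

End OperatorsAsQuotients.

(** * The norm of W and the operator distance *)

Section WNorm.
Context {R : realType} {d : nat}.
Local Notation V := 'rV[R]_d.
Variable L : set V.

Lemma Wnorm_le1_W1ball (g : cfun R d) : L !=set0 -> (Wnorm L g <= 1)%E ->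
  W1ball L g.1 /\ W1ball L g.2.
Proof.
move=> [x0 Lx0]; rewrite /Wnorm; case: asboolP => // -[[d1 _] [d2 _]].
set s1 := ereal_sup _; set s2 := ereal_sup _ => s12.
have h1 x : L x -> ((cabs g x)%:E <= s1)%E.
  by move=> Lx; apply: ereal_sup_ubound; exists x.
have h2 x : L x -> ((cgradnorm g x)%:E <= s2)%E.
  by move=> Lx; apply: ereal_sup_ubound; exists x.
(* A point of [L] makes both suprema nonnegative, so each of them separately is at most [1]. *)
have s10 : (0 <= s1)%E by apply: le_trans (h1 _ Lx0); rewrite lee_fin sqrtr_ge0.
have s20 : (0 <= s2)%E by apply: le_trans (h2 _ Lx0); rewrite lee_fin sqrtr_ge0.
have c1 x : L x -> cabs g x <= 1.
  move=> Lx; rewrite -lee_fin; apply: le_trans (h1 x Lx) (le_trans _ s12).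
  by rewrite leeDl.
have c2 x : L x -> cgradnorm g x <= 1.
  move=> Lx; rewrite -lee_fin; apply: le_trans (h2 x Lx) (le_trans _ s12).
  by rewrite leeDr.
have sq (a b c : R) : 0 <= b -> a ^+ 2 + b <= c -> `|a| <= Num.sqrt c.
  by move=> b0 abc; rewrite -sqrtr_sqr ler_wsqrtr// (le_trans _ abc)// lerDl.
have gr x i (a b : R) : 0 <= b ->
    a ^+ 2 + b <= partial g.1 i x ^+ 2 + partial g.2 i x ^+ 2 -> `|a| <= cgradnorm g x.
  move=> b0 ab; apply: (sq _ b) => //; rewrite (bigD1 i)//= (le_trans ab)// lerDl.
  by apply: sumr_ge0 => j _; rewrite addr_ge0 ?sqr_ge0.
split=> x Lx; split.
- by apply: le_trans (c1 x Lx); apply: (sq _ (g.2 x ^+ 2)) => //; exact: sqr_ge0.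
- exact: d1.
- by move=> i; apply: le_trans (c2 x Lx); apply: (gr _ i _ (partial g.2 i x ^+ 2));
    [exact: sqr_ge0|exact: lexx].
- by apply: le_trans (c1 x Lx); apply: (sq _ (g.1 x ^+ 2)); rewrite ?sqr_ge0// addrC.
- exact: d2.
- by move=> i; apply: le_trans (c2 x Lx); apply: (gr _ i _ (partial g.1 i x ^+ 2));
    [exact: sqr_ge0|rewrite addrC; exact: lexx].
Qed.

(** The modulus is at most the sum of the absolute real and imaginary parts, giving [2 * e]; the
    gradient norm is at most the sum of [d] such terms. *)
Lemma Wnorm_le (g : cfun R d) (e : R) : 0 <= e -> C1on L g.1 -> C1on L g.2 ->
  (forall x, L x -> `|g.1 x| <= e /\ `|g.2 x| <= e) ->
  (forall x i, L x -> `|partial g.1 i x| <= e /\ `|partial g.2 i x| <= e) ->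
  (Wnorm L g <= ((2 + 2 * d%:R) * e)%:E)%E.
Proof.
move=> e0 c1 c2 ge pe; rewrite /Wnorm asboolT// mulrDl EFinD leeD//.
  apply: ge_ereal_sup => _ /= [x Lx <-]; rewrite lee_fin.
  have [h1 h2] := ge x Lx.
  apply: (@le_trans _ _ (`|g.1 x| + `|g.2 x|)); last by rewrite mulr_natl mulr2n lerD.
  rewrite -(@ger0_norm _ (`|g.1 x| + `|g.2 x|)) ?addr_ge0// -sqrtr_sqr.
  apply: ler_wsqrtr; rewrite sqrrD !real_normK ?num_real//.
  by rewrite [leRHS]addrAC lerDl mulrn_wge0// mulr_ge0.
apply: ge_ereal_sup => _ /= [x Lx <-]; rewrite lee_fin.
apply: (@le_trans _ _ (Num.sqrt (\sum_i (`|partial g.1 i x| + `|partial g.2 i x|) ^+ 2))).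
  apply: ler_wsqrtr; apply: ler_sum => i _.
  move: (partial _ _ _) (partial _ _ _) => p q; rewrite sqrrD !real_normK ?num_real//.
  by rewrite [leRHS]addrAC lerDl mulrn_wge0// mulr_ge0.
apply: (le_trans (sqrt_sum_sqr_le _)).
apply: (@le_trans _ _ (\sum_(i < d) 2 * e)).
  apply: ler_sum => i _; have := pe x i Lx.
  move: (partial _ _ _) (partial _ _ _) => p q [h1 h2].
  by rewrite ger0_norm ?addr_ge0// mulr_natl mulr2n lerD.
by rewrite sumr_const card_ord -[leLHS]mulr_natl mulrA (mulrC d%:R) lexx.
Qed.

Lemma Wnorm_ge0 (g : cfun R d) : L !=set0 -> (0 <= Wnorm L g)%E.
Proof.
move=> [x Lx]; rewrite /Wnorm; case: asboolP => // _; rewrite adde_ge0//.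
  apply: (@le_trans _ _ (cabs g x)%:E); first by rewrite lee_fin sqrtr_ge0.
  by apply: ereal_sup_ubound; exists x.
apply: (@le_trans _ _ (cgradnorm g x)%:E); first by rewrite lee_fin sqrtr_ge0.
by apply: ereal_sup_ubound; exists x.
Qed.

(** The zero function belongs to the unit ball, so the supremum is over a nonempty set and cannot be
    [-oo]. *)
Lemma opdist_ge0 (A B : cfun R d -> cfun R d) : L !=set0 -> (0 <= opdist L A B)%E.
Proof.
move=> L0; pose g0 : cfun R d := (fun=> 0, fun=> 0).
apply: (le_trans (Wnorm_ge0 (csub (A g0) (B g0)) L0)).
apply: ereal_sup_ubound; exists g0 => //=.
have p0 i x : partial (fun _ : V => 0 : R) i x = 0.
  by rewrite /partial (diff_cst (V := V) (W := R) 0 x).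
have c0 : C1on L (fun _ : V => 0 : R).
  split=> [x _|i]; first exact: differentiable_cst.
  have -> : partial (fun _ : V => 0 : R) i = fun=> 0 by apply/funext => x; rewrite p0.
  by move=> x; exact: cst_continuous.
have := @Wnorm_le g0 0 (lexx 0) c0 c0; rewrite mulr0 => H.
apply: (le_trans (H _ _)); rewrite ?lee_fin//.
  by move=> x _ /=; rewrite normr0.
by move=> x i _ /=; rewrite p0 normr0.
Qed.

End WNorm.

(** * Positivity of the limit denominator on L(t) *)

Section Positivity.
Context {R : realType} {d : nat} {dT : measure_display} {T : measurableType dT}.
Local Notation V := 'rV[R]_d.
Variables (P : probability T R) (X : nat -> T -> V) (f : V -> R) (t M : R).
Variables (k : V -> R) (h B : R).
Hypothesis mX : forall i A, borel_rV A -> measurable (X i @^-1` A).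
Hypothesis density : forall a b : nat -> R,
  P (X 0%N @^-1` box a b) = box_integral a b f.
Hypothesis df : forall x, differentiable f x.
Hypothesis cdf : forall i, continuous (partial f i).
Hypothesis fM : forall x, f x <= M.
Hypothesis t0 : 0 < t.
Hypothesis pf : forall x, f x = t -> exists i, partial f i x != 0.
Hypothesis k0 : forall x, 0 <= k x.
Hypothesis kc : exists2 c : R, 0 < c & forall x, enorm x <= 1 / 2 -> c <= k x.
Hypothesis h0 : 0 < h.
Hypothesis lk : lipschitz_bounded (kh k h) B.

Let cf : continuous f.
Proof. by move=> x; apply: differentiable_continuous; exact: df. Qed.

(** At a point with [f x = t], a short move along an axis with nonzero partial, in the direction
    given by its sign, increases [f]. *)
Lemma superlevel_nearby x (rho : R) : lev f t x -> 0 < rho ->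
  exists2 y, `|y - x| < rho & t < f y.
Proof.
rewrite /lev/= le_eqVlt => /predU1P[tx|tx] rho0; last first.
  by exists x; rewrite ?subrr ?normr0.
have [i pi0] := pf (esym tx); pose sg := Num.sg (partial f i x).
have sgn : \forall z \near x, 0 < sg * partial f i z.
  have : sg * partial f i z @[z --> x] --> sg * partial f i x.
    by apply: (@cvgM _ _ (nbhs x) _ (fun=> sg) (partial f i)); [exact: cvg_cst|exact: cdf].
  by move/cvgr_gt; apply; rewrite -normrEsg normr_gt0.
have /nbhs_ballP[r /= r0 hr] := sgn.
pose e := Num.min rho r / 2.
have m0 : 0 < Num.min rho r by rewrite lt_min rho0 r0.
have e0 : 0 < e by rewrite divr_gt0.
have em : e < Num.min rho r by rewrite ltr_pdivrMr// mulr_natr mulr2n ltrDl.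
clearbody e; have [erho er] : e < rho /\ e < r by move: em; rewrite lt_min => /andP[].
pose y : V := x + (e * sg) *: evec R i.
have yx : y - x = (e * sg) *: evec R i by rewrite /y addrC addKr.
have nyx : `|y - x| <= e.
  rewrite yx; apply: norm_le_coord => [|j]; first exact: ltW.
  rewrite !mxE eqxx/= !normrM (gtr0_norm e0) /sg normr_sg pi0 mulr1.
  by case: (j == i); rewrite ?normr1 ?normr0 ?mulr1 ?mulr0// ltW.
exists y; first exact: le_lt_trans nyx erho.
have [|s s01 fyx] := @segment_MVT _ _ f x y; first by move=> *; exact: df.
move: fyx; rewrite {1}tx (bigD1 i)//= big1 ?addr0; last first.
  by move=> j ji; rewrite {1}yx !mxE (negbTE ji) andbF mulr0 mul0r.
rewrite {1}yx !mxE !eqxx mulr1 => fyx; rewrite -subr_gt0 fyx -mulrA mulr_gt0//.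
apply: hr; apply: ball_segment s01; first exact: ballxx.
by rewrite -ball_normE/= distrC (le_lt_trans nyx er).
Qed.

Lemma levA_one_pos x : lev f t x -> 0 < levA P X f t k h (fun=> 1) x.
Proof.
move=> Lx; have [c c0 hc] := kc.
(* A sup-norm distance at most [rho] gives, after scaling by [1 / h], a Euclidean norm at most
   [d * rho / h <= 1 / 2], where [k] is at least [c]. *)
pose rho := h / (2 * (d%:R + 1)).
have d1 : 0 < d%:R + 1 :> R by rewrite ltr_wpDl.
have rho0 : 0 < rho by rewrite divr_gt0// mulr_gt0.
have rho20 : 0 < rho / 2 by rewrite divr_gt0.
have [y yx ty] := superlevel_nearby Lx rho20.
have kz z : ball y (rho / 2) z -> c <= kh k h (z - x).
  rewrite -ball_normE/= => yz; apply: hc; apply: (le_trans (enorm_le_norm _)).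
  have zx : `|z - x| <= rho.
    have -> : z - x = (y - x) - (y - z) by apply/rowP => i; rewrite !mxE; ring.
    by rewrite (le_trans (ler_normB _ _))// [leRHS](splitr rho) lerD// ltW.
  rewrite normrZ gtr0_norm ?invr_gt0//.
  apply: (@le_trans _ _ ((d%:R + 1) * (h^-1 * rho))).
    by apply: ler_pM => //; [rewrite mulr_ge0// invr_ge0 ltW|rewrite lerDl|
      rewrite ler_wpM2l// invr_ge0 ltW].
  rewrite le_eqVlt; apply/orP; left; apply/eqP; rewrite /rho; field.
  by rewrite !gt_eqF.
have mb : measurable (X 0%N @^-1` ([set z | t <= f z] `&` ball y (rho / 2))).
  apply: mX; apply: borelI; first by apply: borel_closed; exact: closed_superlevel.
  by apply: borel_open; exact: ball_open.
have := superlevel_ball_pos (@mX 0%N) density df fM t0 ty rho20.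
rewrite -Ex_indic// => pos.
apply: (lt_le_trans (mulr_gt0 c0 pos)); rewrite -ExZ; last exact: bounded_rv_indic.
apply: Ex_le.
- by apply: bounded_rvZ; exact: bounded_rv_indic.
- exact: (bounded_rv_kernel mX cf x lk (@W1ball_one R d (lev f t))).
move=> w; rewrite mulr1 [X in c * X]indicE; case: (boolP (w \in _)) => [/set_mem[/= tw yw]|_].
  by rewrite mulr1 indicE mem_set// mul1r; exact: kz.
by rewrite mulr0 mulr_ge0//; exact: k0.
Qed.

End Positivity.

(** * Assembly of the operator convergence *)

Theorem theorem1 (R : realType) (d : nat) (dT : measure_display)
  (T : measurableType dT) (P : probability T R)
  (X : nat -> T -> 'rV[R]_d) (f : 'rV[R]_d -> R) (t : R)
  (k : 'rV[R]_d -> R) (h e0 : R) (eps : nat -> R)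
  (phi phiinv : nat -> 'rV[R]_d -> 'rV[R]_d)
  (fhat : nat -> T -> 'rV[R]_d -> R) :
  (* X_1, X_2, ... (here X 0, X 1, ...) are random vectors of R^d *)
  (forall i A, borel_rV A -> measurable (X i @^-1` A)) ->
  (* identically distributed *)
  (forall i A, borel_rV A -> P (X i @^-1` A) = P (X 0%N @^-1` A)) ->
  (* mutually independent *)
  (forall (n : nat) (A : nat -> set 'rV[R]_d), (forall i, borel_rV (A i)) ->
     P (\bigcap_(i < n) (X i @^-1` A i)) = (\prod_(i < n) P (X i @^-1` A i))%E) ->
  (* the common law mu has Lebesgue density f *)
  (forall a b : nat -> R, P (X 0%N @^-1` box a b) = box_integral a b f) ->
  (* Assumption 1 *)
  C2 f ->
  (forall x, f x = t -> 0 < enorm (grad f x)) ->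
  (exists M : R, forall x, `|f x| <= M /\ enorm (grad f x) <= M /\
      (forall i j, `|partial (partial f i) j x| <= M)) ->
  (* the level t *)
  0 < t ->
  (exists2 r : R, 0 < r & forall s, `|s - t| < r -> exists x, f x = s) ->
  lev f t !=set0 ->
  compact (lev f t) ->
  finite_set [set connected_component (lev f t) x | x in lev f t] ->
  (* Assumption 2 *)
  (forall x, 0 <= k x) ->
  C2 k ->
  closure [set x | k x != 0] = @Ball1 R d ->
  (exists2 c : R, 0 < c & forall x, enorm x <= 1 / 2 -> c <= k x) ->
  (forall x, k (- x) = k x) ->
  (* h and eps_0 *)
  0 < h -> 0 < e0 ->
  (forall x, t - e0 <= f x <= t + e0 -> grad f x != 0) ->
  e0 / inf [set enorm (grad f x) | x in lev_ab f (t - e0) t] < h / 2 ->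
  (* eps_n *)
  (forall n, 0 < eps n <= e0) ->
  eps @ \oo --> (0 : R) ->
  (* phi_n *)
  (forall n, C1_diffeo (phi n) (phiinv n)) ->
  (forall n, phi n @` lev f t = lev f (t - eps n)) ->
  (forall e : R, 0 < e -> \forall n \near \oo,
     forall x, lev f t x -> enorm (phi n x - x) <= e) ->
  (forall e : R, 0 < e -> \forall n \near \oo,
     forall x, lev f t x -> forall i, enorm (partial (phi n) i x - @evec R d i) <= e) ->
  (* the density estimate hat f_n, built from X_1, ..., X_n *)
  (forall n w x, differentiable (fhat n w) x) ->
  (forall n w1 w2, (forall j, (j < n)%N -> X j w1 = X j w2) ->
     fhat n w1 = fhat n w2) ->
  (* 1_{Omega_n} -> 1 almost surely *)
  {ae P, forall w, \forall n \near \oo, Omega_ev f (fhat n w) t e0 (eps n)} ->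
  (* conclusion: || hat Q_{n,h} - Q_h ||_W -> 0 almost surely *)
  {ae P, forall w,
     (fun n => opdist (lev f t)
                 (Qhat X f (fhat n w) t e0 (eps n) (phi n) (phiinv n) n w k h)
                 (Qh P (X 0%N) f t k h)) @ \oo --> 0%E}.
Proof.
move=> mX idX indX density C2f gradf [M fM] t0 _ L0 cL _ k0 C2k suppk kc _ h0 e00 _ _.
move=> epsP eps0 diffeo phiL phi_id dphi_id _ _ aeOmega.
have [df [dpf _]] := C2f.
have cdf i : continuous (partial f i).
  by move=> x; apply: differentiable_continuous; exact: dpf.
have cf : continuous f by move=> x; apply: differentiable_continuous; exact: df.
have pfM x i : `|partial f i x| <= M.
  have [_ [gM _]] := fM x; apply: le_trans gM.
  by have := coord_le_enorm (grad f x) i; rewrite mxE.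
have lipf := globally_lipschitz df pfM.
have M0 : 0 <= M by have [h1 _] := fM 0; exact: le_trans (normr_ge0 _) h1.
have K0 : 0 <= d%:R * M by rewrite mulr_ge0.
have fleM x : f x <= M by have [h1 _] := fM x; exact: le_trans (ler_norm _) h1.
have pf x : f x = t -> exists i, partial f i x != 0.
  move=> /gradf; apply: contraPP => /forallNP np.
  rewrite /enorm big1 ?sqrtr0 ?ltxx// => i _; rewrite mxE.
  by have /negP := np i; rewrite negbK => /eqP ->; rewrite expr0n.
have phiK n : cancel (phi n) (phiinv n) by have [] := diffeo n.
have C1phi n : C1 (phi n) by have [_ [_ []]] := diffeo n.
have phin (e : R) : 0 < e -> \forall n \near \oo,
    forall x, lev f t x -> `|phi n x - x| <= e.
  move=> e_0; apply: filterS (phi_id e e_0) => n H x Lx.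
  exact: le_trans (norm_le_enorm _) (H x Lx).
have band := small_band (@mX 0%N) density df cdf lipf fleM t0 K0 pf cL.
have [B [lk lpk]] := kh_lipschitz_bounded C2k suppk h0.
have B0 : 0 <= B by have [bk _] := lk; exact: le_trans (normr_ge0 _) (bk 0).
have dk := differentiable_kh h C2k.
set L := lev f t in L0 cL phi_id dphi_id phin *.
pose a (g : 'rV[R]_d -> R) := levA P X f t k h g.
have aC1 g : W1ball L g -> C1_bounded (a g) B /\ forall i x, partial (a g) i x =
    - lev_int P (X 0%N) f t (fun y => partial (kh k h) i (y - x) * g y).
  move=> Wg; apply: (@Lam_translate_C1_bounded _ _
    (fun F => lev_int P (X 0%N) f t (fun y => F y * g y)) (kh k h) B) => //.
    by move=> c F G cF cG; apply: lev_int_lin => //; exact: mX.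
  by move=> F C cF C0 bF; apply: lev_int_le => //; exact: mX.
have W1 := @W1ball_one R d L.
have [[da1 cpa1 _ _] _] := aC1 _ W1.
have apos x : L x -> 0 < a (fun=> 1) x.
  exact: (levA_one_pos mX density df cdf fleM t0 pf k0 kc h0 lk).
(* The limit denominator is continuous and positive on the compact L(t), so its minimum bounds it
   away from zero. *)
have [b b0 hb] : exists2 b : R, 0 < b & forall x, L x -> b <= a (fun=> 1) x.
  have [|c /set_mem Lc hc] := @compact_EVT_min _ _ (a (fun=> 1)) L L0 cL.
    by apply: continuous_subspaceT => x; apply: differentiable_continuous; exact: da1.
  by exists (a (fun=> 1) c); [exact: apos|move=> x Lx; apply: hc; exact/mem_set].
have p0 : fine (P (X 0%N @^-1` L)) != 0.
  have [x Lx] := L0.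
  have [y _ ty] := superlevel_nearby df cdf pf Lx (ltr01 (R := R)).
  have := superlevel_ball_pos (@mX 0%N) density df fleM t0 ty (ltr01 (R := R)).
  apply: contraTneq => pL0; rewrite -leNgt -pL0.
  have bL : borel_rV L by apply: borel_closed; exact: closed_superlevel.
  have mb : measurable (X 0%N @^-1` ([set x | t <= f x] `&` ball y 1)).
    by apply: mX; apply: borelI => //; apply: borel_open; exact: ball_open.
  rewrite fine_le ?fin_num_measure//; [exact: mX|].
  by rewrite le_measure ?inE//; [exact: mX|move=> w []].
(* Tolerances [1 / (m + 1)] are countably many, so one null set serves all of them. *)
have aeLLN : {ae P, forall w, forall m : nat, \forall n \near \oo,
    forall fn : 'rV[R]_d -> R, (forall x, `|fn x - f x| <= eps n) ->
    forall ka g x, lipschitz_bounded ka B -> W1ball L g -> L x ->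
    `|emp_int X fn t n w (fun y => ka (y - phi n x) * g (phiinv n y)) -
      lev_int P (X 0%N) f t (fun y => ka (y - x) * g y)| <= m.+1%:R^-1}.
  apply: ae_foralln => m.
  exact: (uniform_lln mX idX indX cf K0 lipf cL band eps0 phiK phiL phin B0 (_ : 0 < m.+1%:R^-1)).
apply: filterS2 aeOmega aeLLN => w Om LLN.
pose A n (g : 'rV[R]_d -> R) := empA X t k h (fhat n w) (phiinv n) n w g.
have AC1 n g : Omega_ev f (fhat n w) t e0 (eps n) -> W1ball L g ->
    C1_bounded (A n g) B /\ forall i x, partial (A n g) i x =
    - emp_int X (fhat n w) t n w (fun y => partial (kh k h) i (y - x) * g (phiinv n y)).
  move=> [On _] Wg; apply: (@Lam_translate_C1_bounded _ _
    (fun F => emp_int X (fhat n w) t n w (fun y => F y * g (phiinv n y))) (kh k h) B) => //.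
    by move=> c F G _ _; exact: (emp_int_lin _ _ _ _ _ (fun y => g (phiinv n y))).
  move=> F C _ C0 bF; apply: (@emp_int_le _ _ _ _ _ _ _ _ (fun y => g (phiinv n y))) => // j tj.
  have : lev f (t - eps n) (X j w).
    by have := On (X j w); rewrite /lev/= ler_norml => /andP[h1 h2]; lra.
  by rewrite -phiL => -[z Lz <-]; rewrite phiK; have [] := Wg z Lz.
(* Taking pairs as indices makes every limit below uniform in the point and in [g] at once, as the
   operator norm demands. *)
pose Dom : set ('rV[R]_d * ('rV[R]_d -> R)) := [set xg | L xg.1 /\ W1ball L xg.2].
have ulln ka : lipschitz_bounded ka B -> ucvg Dom
    (fun n xg => emp_int X (fhat n w) t n w (fun y => ka (y - phi n xg.1) * xg.2 (phiinv n y)))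
    (fun xg => lev_int P (X 0%N) f t (fun y => ka (y - xg.1) * xg.2 y)).
  move=> lka e e_0; apply: filterS2 Om (LLN (Num.truncn e^-1)) => n [On _] H [x g] [/= Lx Wg].
  apply: le_trans (H _ On _ _ _ lka Wg Lx) _.
  by rewrite -[leRHS]invrK lef_pV2 ?posrE ?invr_gt0//; exact/ltW/truncnS_gt.
have uA : ucvg Dom (fun n xg => A n xg.2 (phi n xg.1)) (fun xg => a xg.2 xg.1).
  exact: (ulln _ lk).
have upA j : ucvg Dom (fun n xg => partial (A n xg.2) j (phi n xg.1))
    (fun xg => partial (a xg.2) j xg.1).
  move=> e e_0; apply: filterS2 Om (ucvgN (ulln _ (lpk j)) e_0) => n On H xg Dxg.
  have [_ ->] := AC1 n xg.2 On Dxg.2; have [_ ->] := aC1 xg.2 Dxg.2; exact: H.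
(* The denominators are the numerators of the constant function [1], so their convergence is a
   special case. *)
have to1 (u : nat -> ('rV[R]_d -> R) -> 'rV[R]_d -> R) (v : ('rV[R]_d -> R) -> 'rV[R]_d -> R) :
    ucvg Dom (fun n xg => u n xg.2 xg.1) (fun xg => v xg.2 xg.1) ->
    ucvg Dom (fun n xg => u n (fun=> 1) xg.1) (fun xg => v (fun=> 1) xg.1).
  move=> uv e e_0; apply: filterS (uv e e_0) => n H xg [Lx _].
  by apply: (H (xg.1, fun=> 1)); split.
have uA1 := to1 (fun n g x => A n g (phi n x)) a uA.
have upA1 j := to1 (fun n g x => partial (A n g) j (phi n x)) (fun g => partial (a g) j) (upA j).
have bdd v : (forall xg, Dom xg -> `|v xg| <= B) -> ubounded Dom v.
  move=> H; exists (B + 1); first by rewrite ltr_wpDl.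
  by move=> xg /H /le_trans; apply; rewrite lerDl.
have ba : ubounded Dom (fun xg => a xg.2 xg.1).
  by apply: bdd => xg [_ Wg]; have [[]] := aC1 _ Wg.
have ba1 : ubounded Dom (fun xg => a (fun=> 1) xg.1).
  by apply: bdd => xg _; have [[]] := aC1 _ W1.
have bpa j : ubounded Dom (fun xg => partial (a xg.2) j xg.1).
  by apply: bdd => xg [_ Wg]; have [[]] := aC1 _ Wg.
have bpa1 j : ubounded Dom (fun xg => partial (a (fun=> 1)) j xg.1).
  by apply: bdd => xg _; have [[]] := aC1 _ W1.
have hbD xg : Dom xg -> b <= a (fun=> 1) xg.1 by move=> [Lx _]; exact: hb.
have uV := ucvgV b0 hbD uA1; have bV := uboundedV b0 hbD.
have partial_id i x : partial (id : 'rV[R]_d -> 'rV[R]_d) i x = evec R i.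
  by rewrite /partial; have [_ ->] := is_diff_id x.
have uquot : ucvg Dom (fun n xg => quot (A n xg.2) (A n (fun=> 1)) (phi n) xg.1)
    (fun xg => quot (a xg.2) (a (fun=> 1)) id xg.1).
  exact: ucvgM.
have udquot i : ucvg Dom (fun n xg => dquot (A n xg.2) (A n (fun=> 1)) (phi n) i xg.1)
    (fun xg => dquot (a xg.2) (a (fun=> 1)) id i xg.1).
  apply: ucvg_sum => j; apply: ucvgM.
  - exists 1 => // xg _; rewrite partial_id mxE.
    by case: (_ && _); rewrite ?normr1 ?normr0.
  - apply: uboundedM; last exact: uboundedM.
    by apply: uboundedD; [exact: uboundedM|apply: uboundedN; exact: uboundedM].
  (* The limit operator is the quotient composed with [id], so the Jacobian of [phi n] has to
     converge to the basis vectors given by [partial_id]. *)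
  - move=> e e_0; apply: filterS (dphi_id e e_0) => n H xg [Lx _].
    rewrite partial_id; have := coord_le_enorm (partial (phi n) i xg.1 - evec R i) j.
    by rewrite [X in `|X|]mxE [X in _ + X]mxE => /le_trans; apply; exact: H.
  - apply: ucvgM.
    + by apply: uboundedD; [exact: uboundedM|apply: uboundedN; exact: uboundedM].
    + exact: uboundedM.
    + by apply: ucvgD; [exact: ucvgM|apply: ucvgN; exact: ucvgM].
    + exact: ucvgM.
have C1id : C1 (id : 'rV[R]_d -> 'rV[R]_d).
  split=> [x|i]; first by have [] := is_diff_id x.
  have -> : partial (id : 'rV[R]_d -> 'rV[R]_d) i = fun=> evec R i.
    by apply/funext => x; exact: partial_id.
  exact: cst_continuous.
have quotC1 (A1 D1 : 'rV[R]_d -> R) (ph : 'rV[R]_d -> 'rV[R]_d) :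
    C1_bounded A1 B -> C1_bounded D1 B -> C1 ph -> (forall x, L x -> D1 (ph x) != 0) ->
    [/\ C1on L (quot A1 D1 ph), forall x, L x -> differentiable (quot A1 D1 ph) x &
    forall i x, L x -> partial (quot A1 D1 ph) i x = dquot A1 D1 ph i x].
  move=> [dA cA _ _] [dD cD _ _] [dph cph] D0.
  have q x (Lx : L x) := quot_diff (dA (ph x)) (dD (ph x)) (dph x) (D0 x Lx).
  have qd x : L x -> differentiable (quot A1 D1 ph) x by move=> /q[].
  have qp i x : L x -> partial (quot A1 D1 ph) i x = dquot A1 D1 ph i x.
    by move=> /q[_]; exact.
  split; [|exact: qd|exact: qp]; apply: (C1on_of_partial qd qp) => i x Lx.
  by apply: continuous_dquot => //; [move=> z..|exact: D0];
    apply: differentiable_continuous.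
have key (e : R) : 0 < e -> \forall n \near \oo, (opdist L
    (Qhat X f (fhat n w) t e0 (eps n) (phi n) (phiinv n) n w k h)
    (Qh P (X 0%N) f t k h) <= ((2 + 2 * d%:R) * e)%:E)%E.
  move=> e_0; have b20 : 0 < b / 2 by rewrite divr_gt0.
  have updall : \forall n \near \oo, forall i xg, Dom xg ->
      `|dquot (A n xg.2) (A n (fun=> 1)) (phi n) i xg.1 -
        dquot (a xg.2) (a (fun=> 1)) id i xg.1| <= e.
    by apply: filter_forall => i; exact: udquot.
  (* Denominators within [b / 2] of a limit that is at least [b] stay nonzero, which makes the
     empirical quotients differentiable on L(t). *)
  apply: filterS2 (filterI Om (uA1 _ b20)) (filterI updall (uquot e e_0)).
  move=> n [On A1n] [Hd Hq]; apply: ge_ereal_sup => _ /= [g gW <-].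
  have [Wg1 Wg2] := Wnorm_le1_W1ball L0 gW.
  have A1pos x : L x -> A n (fun=> 1) (phi n x) != 0.
    move=> Lx; have := A1n (x, fun=> 1) (conj Lx W1); rewrite /= ler_norml => /andP[h1 _].
    rewrite gt_eqF//; move: h1 (hb x Lx).
    by move: (A n _ _) (a _ _) => p q h1 h2; clear - b0 h1 h2; lra.
  have a1pos x : L x -> a (fun=> 1) x != 0 by move=> /apos ?; rewrite gt_eqF.
  have QhE (g1 : 'rV[R]_d -> R) : W1ball L g1 ->
      (fun x => mut_int P (X 0%N) f t (fun y => qh P (X 0%N) f t k h x y * g1 y)) =
      quot (a g1) (a (fun=> 1)) id.
    by move=> Wg; apply/funext => x; exact: (mut_int_quot _ mX cf lk Wg p0).
  have QnE (g1 : 'rV[R]_d -> R) :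
      (fun x => Pnt_int X (fhat n w) t n w
         (fun y => qnh X (fhat n w) t n w k h (phi n x) y * g1 (phiinv n y))) =
      quot (A n g1) (A n (fun=> 1)) (phi n).
    by apply/funext => x; exact: Pnt_int_quot.
  rewrite /Qhat asboolT// /Qh /csub /= !QnE !QhE//.
  have qa g1 (Wg : W1ball L g1) := quotC1 _ _ _ (aC1 g1 Wg).1 (aC1 _ W1).1 C1id a1pos.
  have qA g1 (Wg : W1ball L g1) := quotC1 _ _ _ (AC1 n g1 On Wg).1 (AC1 n _ On W1).1 (C1phi n) A1pos.
  have [ca1 da_1 pa_1] := qa _ Wg1; have [ca2 da_2 pa_2] := qa _ Wg2.
  have [cA1 dA_1 pA_1] := qA _ Wg1; have [cA2 dA_2 pA_2] := qA _ Wg2.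
  apply: Wnorm_le; [exact: ltW|exact: C1onB|exact: C1onB| |].
    by move=> x Lx; split; [exact: (Hq (x, g.1) (conj Lx Wg1))|exact: (Hq (x, g.2) (conj Lx Wg2))].
  move=> x i Lx /=; rewrite !partialB; [|exact: dA_2|exact: da_2|exact: dA_1|exact: da_1].
  rewrite pA_1// pa_1// pA_2// pa_2//.
  by split; [exact: (Hd i (x, g.1) (conj Lx Wg1))|exact: (Hd i (x, g.2) (conj Lx Wg2))].
have c0 : 0 < 2 + 2 * d%:R :> R by rewrite ltr_pwDl// mulr_ge0.
(* Extended-real convergence splits into eventual finiteness, from [key] and [opdist_ge0], and
   convergence of the real values. *)
apply/fine_cvgP; split.
  apply: filterS (key 1 ltr01) => n le1; rewrite ge0_fin_numE; last exact: opdist_ge0.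
  exact: le_lt_trans le1 (ltry _).
apply/cvgr0Pnorm_le => e e_0.
have ec : 0 < e / (2 + 2 * d%:R) by rewrite divr_gt0.
apply: filterS (key _ ec) => n /=; rewrite mulrC divfK ?gt_eqF// => le_e.
have ge0 := opdist_ge0 (Qhat X f (fhat n w) t e0 (eps n) (phi n) (phiinv n) n w k h)
  (Qh P (X 0%N) f t k h) L0.
rewrite ger0_norm ?fine_ge0// -lee_fin fineK// ge0_fin_numE//.
exact: le_lt_trans le_e (ltry _).
Qed.
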